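(* Let $K\ge1$ and let $f=h+\overline{g}$ be a $K$-quasiregular harmonic mapping in the unit disk $\mathbb{D}$, with $h,g$ analytic in $\mathbb{D}$, such that $f(0)=0$ and $\lambda_f(0)=1$. If $h$ belongs to the Bloch space, i.e., $\sup_{z\in\mathbb{D}}(1-|z|^2)|h'(z)|\leq B$ for some $B>0$, then $B\geq1$, $f$ is univalent in the disk $\mathbb{D}_{r_{12}}$ and $f(\mathbb{D}_{r_{12}})$ contains a schlicht disk $\mathbb{D}_{r_{13}}$, where $$r_{12}=\frac{K+1}{3\sqrt{3}\,KB}\quad\text{and}\quad r_{13}=\frac{\sqrt{3}\,KB}{K+1}\left(1+\left(\frac{9K^2B^2}{(K+1)^2}-1\right)\log\left(1-\frac{(K+1)^2}{9K^2B^2}\right)\right).$$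
   Context: $\mathbb{D}_r(a)=\{z\in\mathbb{C}:|z-a|<r\}$, $\mathbb{D}_r=\mathbb{D}_r(0)$, $\mathbb{D}=\mathbb{D}_1$. A harmonic mapping in $\mathbb{D}$ is a complex-valued, twice continuously differentiable function $f$ with $4f_{z\bar z}=0$; it can be written $f=h+\overline{g}$ with $h,g$ analytic in $\mathbb{D}$. Put $\Lambda_f(z)=|f_z(z)|+|f_{\bar z}(z)|=|h'(z)|+|g'(z)|$, $\lambda_f(z)=\big||f_z(z)|-|f_{\bar z}(z)|\big|=\big||h'(z)|-|g'(z)|\big|$, and $J_f(z)=|h'(z)|^2-|g'(z)|^2$. The mapping $f$ is sense-preserving if $J_f>0$ in $\mathbb{D}$. A sense-preserving harmonic mapping $f$ is $K$-quasiregular ($K\ge1$) in $\mathbb{D}$ if $\Lambda_f(z)\le K\lambda_f(z)$ for all $z\in\mathbb{D}$. Univalent means injective. A disk $\mathbb{D}_\rho(a)$ is a schlicht disk of $f$ if there is a subdomain $\Omega\subset\mathbb{D}$ such that $f$ is univalent in $\Omega$ and $f(\Omega)=\mathbb{D}_\rho(a)$; ''$f(\mathbb{D}_r)$ contains a schlicht disk $\mathbb{D}_\rho$'' means that $\Omega$ can be taken inside $\mathbb{D}_r$. *)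

(* Defs.v *)
(* Stdlib reals with Coquelicot's complex numbers C = R * R. *)
From Stdlib Require Import Reals.
From Coquelicot Require Import Coquelicot.
Open Scope R_scope.

Definition disk (a : C) (r : R) (z : C) : Prop := Cmod (z - a)%C < r.

Definition unit_disk : C -> Prop := disk (RtoC 0) 1.

(** Real partial derivatives of a complex-valued function of z = x + iy, taken
    componentwise.  [Derive] is total, so existence is recorded separately. *)
Definition pdx (f : C -> C) (z : C) : C :=
  (Derive (fun x => Re (f (x, Im z))) (Re z),
   Derive (fun x => Im (f (x, Im z))) (Re z)).

Definition pdy (f : C -> C) (z : C) : C :=
  (Derive (fun y => Re (f (Re z, y))) (Im z),
   Derive (fun y => Im (f (Re z, y))) (Im z)).

Definition ex_pdx (f : C -> C) (z : C) : Prop :=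
  ex_derive (fun x : R => Re (f (x, Im z))) (Re z) /\
  ex_derive (fun x : R => Im (f (x, Im z))) (Re z).

Definition ex_pdy (f : C -> C) (z : C) : Prop :=
  ex_derive (fun y : R => Re (f (Re z, y))) (Im z) /\
  ex_derive (fun y : R => Im (f (Re z, y))) (Im z).

(** [k] times continuously differentiable, in the real sense, on the open
    set [U]. *)
Fixpoint class_C (k : nat) (U : C -> Prop) (f : C -> C) : Prop :=
  (forall z : C, U z -> continuous f z) /\
  match k with
  | O => True
  | S k' =>
      (forall z : C, U z -> ex_pdx f z /\ ex_pdy f z) /\
      class_C k' U (pdx f) /\ class_C k' U (pdy f)
  end.

(** Wirtinger derivatives f_z and f_{\bar z}. *)
Definition dz (f : C -> C) (z : C) : C := ((pdx f z - Ci * pdy f z) / 2)%C.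

Definition dzbar (f : C -> C) (z : C) : C := ((pdx f z + Ci * pdy f z) / 2)%C.

Definition harmonic_mapping (f : C -> C) : Prop :=
  class_C 2 unit_disk f /\
  forall z : C, unit_disk z -> (4 * dzbar (dz f) z)%C = RtoC 0.

Definition analytic (h : C -> C) : Prop :=
  forall z : C, unit_disk z -> ex_derive (K := C_AbsRing) (V := C_NormedModule) h z.

Definition Lambda (f : C -> C) (z : C) : R := Cmod (dz f z) + Cmod (dzbar f z).

Definition lambda (f : C -> C) (z : C) : R :=
  Rabs (Cmod (dz f z) - Cmod (dzbar f z)).

Definition Jacobian (f : C -> C) (z : C) : R :=
  Cmod (dz f z) ^ 2 - Cmod (dzbar f z) ^ 2.

Definition sense_preserving (f : C -> C) : Prop :=
  forall z : C, unit_disk z -> 0 < Jacobian f z.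

Definition quasiregular_harmonic (K : R) (f : C -> C) : Prop :=
  harmonic_mapping f /\ sense_preserving f /\
  forall z : C, unit_disk z -> Lambda f z <= K * lambda f z.

Definition bloch_seminorm (h : C -> C) : Rbar :=
  Lub_Rbar (fun x : R =>
    exists z : C, unit_disk z /\ x = (1 - Cmod z ^ 2) * Cmod (C_derive h z)).

Definition univalent_in (f : C -> C) (U : C -> Prop) : Prop :=
  forall z w : C, U z -> U w -> f z = f w -> z = w.

Definition connected_set (S : C -> Prop) : Prop :=
  forall U V : C -> Prop, open U -> open V ->
    (forall z : C, S z -> U z \/ V z) ->
    (exists z : C, S z /\ U z) -> (exists z : C, S z /\ V z) ->
    exists z : C, S z /\ U z /\ V z.

Definition domain (Omega : C -> Prop) : Prop :=
  open Omega /\ connected_set Omega /\ exists z : C, Omega z.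

(** [f] maps a subdomain of the unit disk contained in [U] univalently onto
    D_rho(a).  A domain is nonempty, so this forces 0 < rho. *)
Definition contains_schlicht_disk
    (f : C -> C) (U : C -> Prop) (a : C) (rho : R) : Prop :=
  exists Omega : C -> Prop,
    domain Omega /\
    (forall z : C, Omega z -> unit_disk z) /\
    (forall z : C, Omega z -> U z) /\
    univalent_in f Omega /\
    (forall w : C, disk a rho w <-> exists z : C, Omega z /\ f z = w).

Definition r12 (K B : R) : R := (K + 1) / (3 * sqrt 3 * K * B).

Definition r13 (K B : R) : R :=
  sqrt 3 * K * B / (K + 1) *
  (1 + (9 * K ^ 2 * B ^ 2 / (K + 1) ^ 2 - 1) *
       ln (1 - (K + 1) ^ 2 / (9 * K ^ 2 * B ^ 2))).

(* Main.v *)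
(** Write [M = 2KB/(K+1)], [N = 3M/2], [rho = 1/sqrt 3].  For unimodular [eta] the
    analytic function [phi = h' + eta g'] satisfies [|phi| <= |h'| + |g'| <= M/(1-|z|^2)],
    hence [|phi| < N] on [|z| < rho], and [|phi(0)| >= |h'(0)| - |g'(0)| = 1].  With
    [a = 1/N], the Schwarz-Pick lemma gives, after a rotation of [phi],
    [Re phi(z) >= N (a - s)/(1 - a s)] where [s = |z|/rho]; this is positive for
    [|z| < rho a = r12].  Since [f z1 - f z2] equals the increment of [h + eta g] for a
    suitable [eta], integrating along segments gives injectivity of [f], and along radii
    it gives [|f z| >= N rho int_0^s (a - x)/(1 - a x) dx], whose value at [s = a] is [r13].
    As [f] is an open map, the latter bound and the connectedness of the disk of radius
    [r13] show that this disk is covered.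

    The Schwarz lemma rests on Cauchy's formula for holomorphic functions with continuous
    derivative; the derivatives [h'] and [g'] have this regularity because [f] is of
    class C^2. *)
Require Import Defs.
From Stdlib Require Import Reals Lra Psatz Lia Classical IndefiniteDescription.
From Coquelicot Require Import Coquelicot.
Open Scope R_scope.

(** * Complex continuity and differentiation *)

(** The radius [1 / sqrt 3] is an optimum. With a free radius [rho] the bound is
    [N = M / (1 - rho^2)], so the admissible disk has radius [rho / N = rho * (1 - rho^2) / M],
    which is largest at [rho = 1 / sqrt 3]. The constant [M] comes from quasiregularity, which gives
    [(K + 1) |g'| <= (K - 1) |h'|].

    The obstacle is that [f] is not holomorphic: the [eta] that replaces it by [h + eta g] depends
    on the pair of points compared. Every estimate must therefore be uniform in [eta]. At the origin
    the uniform lower bound for [|h' + eta g'|] is [|h'(0)| - |g'(0)|], which is exactly what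
    [lambda] normalises.

    Openness alone does not give covering, since the image of an open disk need not be relatively
    closed in the target. The growth bound keeps the preimages of each smaller disk in a smaller
    concentric disk, where [f] expands distances by a fixed factor; preimages of a convergent
    sequence are then Cauchy.

    In the Schwarz lemma the integral of the Cauchy kernel is never evaluated: it equals that of the
    positive Poisson kernel, and cancels. *)

Lemma locally_C_Cmod (z : C) (P : C -> Prop) :
  locally z P <-> exists d, 0 < d /\ forall w, Cmod (w - z) < d -> P w.
Proof.
  split.
  - intros [d Hd]. exists d. split; [apply cond_pos|].
    intros w Hw. apply Hd.
    pose proof (Rmax_Cmod (w - z)%C) as HM.
    split; unfold ball; simpl; unfold AbsRing_ball, abs, minus, plus, opp; simpl.
    + eapply Rle_lt_trans; [|apply Hw]. eapply Rle_trans; [|apply HM]. apply Rmax_l.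
    + eapply Rle_lt_trans; [|apply Hw]. eapply Rle_trans; [|apply HM]. apply Rmax_r.
  - intros (d & Hd & H).
    (* Balls of [C = R * R] are squares, and the modulus is at most [sqrt 2 < 2] times the larger
       coordinate, so half the radius suffices. *)
    assert (Hs : 0 < d / 2) by lra.
    exists (mkposreal _ Hs). intros w [H1 H2]. apply H.
    unfold ball in H1, H2; simpl in H1, H2.
    unfold AbsRing_ball, abs, minus, plus, opp in H1, H2; simpl in H1, H2.
    eapply Rle_lt_trans; [apply Cmod_2Rmax|]. simpl.
    assert (sqrt 2 < 2).
    { rewrite <- (sqrt_square 2) at 2 by lra. apply sqrt_lt_1; lra. }
    assert (Rmax (Rabs (fst w + - fst z)) (Rabs (snd w + - snd z)) < d / 2)
      by (apply Rmax_lub_lt; assumption).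
    assert (0 <= Rmax (Rabs (fst w + - fst z)) (Rabs (snd w + - snd z))).
    { eapply Rle_trans; [|apply Rmax_l]. apply Rabs_pos. }
    pose proof (sqrt_pos 2). nra.
Qed.

Lemma continuous_C_Cmod (f : C -> C) (z : C) :
  continuous f z <->
  forall eps, 0 < eps -> exists d, 0 < d /\ forall w, Cmod (w - z) < d -> Cmod (f w - f z) < eps.
Proof.
  split.
  - intros H eps He.
    assert (Hl : locally (f z) (fun w => Cmod (w - f z) < eps)).
    { apply locally_C_Cmod. exists eps. auto. }
    apply H in Hl. unfold filtermap in Hl. apply locally_C_Cmod in Hl. exact Hl.
  - intros H P HP. apply locally_C_Cmod in HP. destruct HP as (e & He & HP).
    destruct (H e He) as (d & Hd & H'). unfold filtermap.
    apply locally_C_Cmod. exists d. auto.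
Qed.

Section ComplexContinuity.
Context {X : UniformSpace}.
Implicit Types F G : X -> C.

Lemma continuous_Re F x : continuous F x -> continuous (fun y => Re (F y)) x.
Proof. intros H. apply (continuous_comp F (fun p : R * R => fst p)); auto. apply continuous_fst. Qed.

Lemma continuous_Im F x : continuous F x -> continuous (fun y => Im (F y)) x.
Proof. intros H. apply (continuous_comp F (fun p : R * R => snd p)); auto. apply continuous_snd. Qed.

Lemma continuous_C_pair (u v : X -> R) x :
  continuous u x -> continuous v x -> continuous (fun y => (u y, v y) : C) x.
Proof.
  intros Hu Hv.
  apply (continuous_comp_2 u v (fun a b => (a, b) : R * R)); auto.
  apply continuous_ext with (f := fun p : R * R => p).
  - now intros [? ?].
  - apply continuous_id.
Qed.

Lemma continuous_Cconst (c : C) x : continuous (fun _ : X => c) x.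
Proof. apply continuous_const. Qed.

Lemma continuous_Cplus F G x :
  continuous F x -> continuous G x -> continuous (fun y => (F y + G y)%C) x.
Proof.
  intros HF HG. apply continuous_C_pair.
  - apply (continuous_plus (V := R_NormedModule)); now apply continuous_Re.
  - apply (continuous_plus (V := R_NormedModule)); now apply continuous_Im.
Qed.

Lemma continuous_Copp F x : continuous F x -> continuous (fun y => (- F y)%C) x.
Proof.
  intros HF. apply continuous_C_pair.
  - apply (continuous_opp (V := R_NormedModule)); now apply continuous_Re.
  - apply (continuous_opp (V := R_NormedModule)); now apply continuous_Im.
Qed.

Lemma continuous_Cminus F G x :
  continuous F x -> continuous G x -> continuous (fun y => (F y - G y)%C) x.
Proof. intros. apply continuous_Cplus; auto. now apply continuous_Copp. Qed.

Lemma continuous_Cmult F G x :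
  continuous F x -> continuous G x -> continuous (fun y => (F y * G y)%C) x.
Proof.
  intros HF HG.
  pose proof (continuous_Re F x HF). pose proof (continuous_Re G x HG).
  pose proof (continuous_Im F x HF). pose proof (continuous_Im G x HG).
  apply continuous_C_pair.
  - apply (continuous_minus (V := R_NormedModule));
      apply (continuous_mult (K := R_AbsRing)); auto.
  - apply (continuous_plus (V := R_NormedModule));
      apply (continuous_mult (K := R_AbsRing)); auto.
Qed.

Lemma continuous_Cconj F x : continuous F x -> continuous (fun y => Cconj (F y)) x.
Proof.
  intros HF. apply continuous_C_pair.
  - now apply continuous_Re.
  - apply (continuous_opp (V := R_NormedModule)); now apply continuous_Im.
Qed.

Lemma Cnorm2_neq_0 (z : C) : z <> RtoC 0 -> fst z ^ 2 + snd z ^ 2 <> 0.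
Proof.
  intros Hz H. apply Hz. destruct z as [a b]; simpl in H.
  assert (a = 0) by nra. assert (b = 0) by nra. now subst.
Qed.

Lemma continuous_Cinv F x :
  continuous F x -> F x <> RtoC 0 -> continuous (fun y => (/ F y)%C) x.
Proof.
  intros HF H0. apply Cnorm2_neq_0 in H0.
  pose proof (continuous_Re F x HF) as HR. pose proof (continuous_Im F x HF) as HI.
  assert (HD : continuous (fun y => / (fst (F y) ^ 2 + snd (F y) ^ 2)) x).
  { apply (continuous_comp (fun y => fst (F y) ^ 2 + snd (F y) ^ 2) Rinv).
    - apply (continuous_plus (V := R_NormedModule)).
      + apply (continuous_mult (K := R_AbsRing) (fun y => fst (F y))); auto.
        apply (continuous_mult (K := R_AbsRing) (fun y => fst (F y))); auto.
        apply continuous_const.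
      + apply (continuous_mult (K := R_AbsRing) (fun y => snd (F y))); auto.
        apply (continuous_mult (K := R_AbsRing) (fun y => snd (F y))); auto.
        apply continuous_const.
    - apply continuous_Rinv. exact H0. }
  apply continuous_C_pair.
  - apply (continuous_mult (K := R_AbsRing)); auto.
  - apply (continuous_mult (K := R_AbsRing)); auto.
    apply (continuous_opp (V := R_NormedModule)); auto.
Qed.

Lemma continuous_Cdiv F G x :
  continuous F x -> continuous G x -> G x <> RtoC 0 -> continuous (fun y => (F y / G y)%C) x.
Proof. intros. apply continuous_Cmult; auto. now apply continuous_Cinv. Qed.

End ComplexContinuity.

(* With [i] the identity of [C] this is complex differentiability; with
   [i := RtoC] it is differentiability of a curve, and both share one calculus. *)
Definition deriv_along {X : Type} (i : X -> C) (F : X -> C) (x : X) (d : C) : Prop :=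
  forall eps, 0 < eps -> exists del, 0 < del /\ forall y,
    Cmod (i y - i x) < del ->
    Cmod (F y - F x - d * (i y - i x)) <= eps * Cmod (i y - i x).

Notation cderiv := (deriv_along (fun z : C => z)).
Notation curve_deriv := (deriv_along RtoC).

Section DerivAlong.
Context {X : Type} (i : X -> C).
Implicit Types F G : X -> C.

Lemma deriv_along_ext F G x d :
  (forall y, F y = G y) -> deriv_along i F x d -> deriv_along i G x d.
Proof.
  intros E H eps He. destruct (H eps He) as (del & Hd & H').
  exists del; split; auto. intros y Hy. rewrite <- !E. auto.
Qed.

Lemma deriv_along_ext_loc F G x d r :
  0 < r -> (forall y, Cmod (i y - i x) < r -> F y = G y) ->
  deriv_along i F x d -> deriv_along i G x d.
Proof.
  intros Hr E H eps He. destruct (H eps He) as (del & Hd & H').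
  exists (Rmin del r); split. now apply Rmin_glb_lt.
  intros y Hy. rewrite <- !E.
  - apply H'. eapply Rlt_le_trans; [apply Hy|apply Rmin_l].
  - replace (i x - i x)%C with (RtoC 0) by ring. now rewrite Cmod_0.
  - eapply Rlt_le_trans; [apply Hy|apply Rmin_r].
Qed.

Lemma deriv_along_const c x : deriv_along i (fun _ => c) x (RtoC 0).
Proof.
  intros eps He. exists 1; split; [lra|]. intros y _.
  replace (c - c - 0 * (i y - i x))%C with (RtoC 0) by ring. rewrite Cmod_0.
  apply Rmult_le_pos; [lra|apply Cmod_ge_0].
Qed.

Lemma deriv_along_id x : deriv_along i i x (RtoC 1).
Proof.
  intros eps He. exists 1; split; [lra|]. intros y _.
  replace (i y - i x - 1 * (i y - i x))%C with (RtoC 0) by ring. rewrite Cmod_0.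
  apply Rmult_le_pos; [lra|apply Cmod_ge_0].
Qed.

Lemma deriv_along_plus F G x a b :
  deriv_along i F x a -> deriv_along i G x b ->
  deriv_along i (fun y => (F y + G y)%C) x (a + b)%C.
Proof.
  intros HF HG eps He.
  destruct (HF (eps / 2)) as (d1 & Hd1 & H1); [lra|].
  destruct (HG (eps / 2)) as (d2 & Hd2 & H2); [lra|].
  exists (Rmin d1 d2); split. now apply Rmin_glb_lt.
  intros y Hy.
  specialize (H1 y (Rlt_le_trans _ _ _ Hy (Rmin_l _ _))).
  specialize (H2 y (Rlt_le_trans _ _ _ Hy (Rmin_r _ _))).
  replace (F y + G y - (F x + G x) - (a + b) * (i y - i x))%C
    with ((F y - F x - a * (i y - i x)) + (G y - G x - b * (i y - i x)))%C by ring.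
  eapply Rle_trans; [apply Cmod_triangle|]. lra.
Qed.

Lemma deriv_along_comp (phi : C -> C) F x a b :
  cderiv phi (F x) b -> deriv_along i F x a ->
  deriv_along i (fun y => phi (F y)) x (b * a)%C.
Proof.
  intros HP HF eps He.
  pose proof (Cmod_ge_0 a) as Ha. pose proof (Cmod_ge_0 b) as Hb.
  (* The cap 1 gives [|F y - F x| <= (|a| + 1) |k|]; the other entry lets the error of [F] be
     multiplied by [|b|]. The [+ 1] in the denominators covers vanishing derivatives. *)
  set (e1 := Rmin 1 (eps / 2 / (Cmod b + 1))).
  assert (He1 : 0 < e1).
  { apply Rmin_glb_lt; [lra|]. apply Rdiv_lt_0_compat; lra. }
  assert (He2 : 0 < eps / 2 / (Cmod a + 1)).
  { apply Rdiv_lt_0_compat; lra. }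
  destruct (HP _ He2) as (d1 & Hd1 & H1).
  destruct (HF _ He1) as (d2 & Hd2 & H2).
  assert (Hd3 : 0 < d1 / (Cmod a + 1)) by (apply Rdiv_lt_0_compat; lra).
  exists (Rmin d2 (d1 / (Cmod a + 1))); split. now apply Rmin_glb_lt.
  intros y Hy.
  specialize (H2 y (Rlt_le_trans _ _ _ Hy (Rmin_l _ _))).
  pose proof (Rlt_le_trans _ _ _ Hy (Rmin_r _ _)) as Hy2.
  set (k := (i y - i x)%C) in *. pose proof (Cmod_ge_0 k) as Hk.
  assert (HFk : Cmod (F y - F x) <= (Cmod a + 1) * Cmod k).
  { replace (F y - F x)%C with ((F y - F x - a * k) + a * k)%C by ring.
    eapply Rle_trans; [apply Cmod_triangle|]. rewrite Cmod_mult.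
    assert (e1 <= 1) by apply Rmin_l. nra. }
  assert (Hlt : Cmod (F y - F x) < d1).
  { eapply Rle_lt_trans; [apply HFk|].
    apply Rmult_lt_reg_l with (/ (Cmod a + 1)). apply Rinv_0_lt_compat; lra.
    rewrite <- Rmult_assoc, Rinv_l by lra. rewrite Rmult_1_l.
    unfold Rdiv in Hy2. lra. }
  specialize (H1 _ Hlt).
  replace (phi (F y) - phi (F x) - b * a * k)%C
    with ((phi (F y) - phi (F x) - b * (F y - F x)) + b * (F y - F x - a * k))%C by ring.
  eapply Rle_trans; [apply Cmod_triangle|]. rewrite Cmod_mult.
  assert (B1 : eps / 2 / (Cmod a + 1) * Cmod (F y - F x) <= eps / 2 * Cmod k).
  { replace (eps / 2 * Cmod k) with (eps / 2 / (Cmod a + 1) * ((Cmod a + 1) * Cmod k))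
      by (field; lra).
    apply Rmult_le_compat_l; [lra|]. exact HFk. }
  assert (B2 : Cmod b * Cmod (F y - F x - a * k) <= eps / 2 * Cmod k).
  { apply Rle_trans with (Cmod b * (eps / 2 / (Cmod b + 1) * Cmod k)).
    - apply Rmult_le_compat_l; auto. eapply Rle_trans; [apply H2|].
      apply Rmult_le_compat_r; auto. apply Rmin_r.
    - replace (eps / 2 * Cmod k) with ((Cmod b + 1) * (eps / 2 / (Cmod b + 1) * Cmod k))
        by (field; lra).
      apply Rmult_le_compat_r; [|lra].
      apply Rmult_le_pos; auto. apply Rlt_le, Rdiv_lt_0_compat; lra. }
  lra.
Qed.

Lemma cderiv_sqr (w : C) : cderiv (fun z => (z * z)%C) w (2 * w)%C.
Proof.
  intros eps He. exists eps; split; auto. intros y Hy.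
  replace (y * y - w * w - 2 * w * (y - w))%C with ((y - w) * (y - w))%C by ring.
  rewrite Cmod_mult. apply Rmult_le_compat_r; [apply Cmod_ge_0|lra].
Qed.

Lemma cderiv_Cmult_l (c w : C) : cderiv (fun z => (c * z)%C) w c.
Proof.
  intros eps He. exists 1; split; [lra|]. intros y Hy.
  replace (c * y - c * w - c * (y - w))%C with (RtoC 0) by ring. rewrite Cmod_0.
  apply Rmult_le_pos; [lra|apply Cmod_ge_0].
Qed.

Lemma deriv_along_scal c F x a :
  deriv_along i F x a -> deriv_along i (fun y => (c * F y)%C) x (c * a)%C.
Proof. intros H. apply (deriv_along_comp (fun z => (c * z)%C)); auto. apply cderiv_Cmult_l. Qed.

Lemma deriv_along_minus F G x a b :
  deriv_along i F x a -> deriv_along i G x b ->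
  deriv_along i (fun y => (F y - G y)%C) x (a - b)%C.
Proof.
  intros HF HG.
  replace (a - b)%C with (a + (- (1)) * b)%C by ring.
  apply deriv_along_ext with (fun y => (F y + (- (1)) * G y)%C).
  - intros; ring.
  - apply deriv_along_plus; auto. now apply deriv_along_scal.
Qed.

(* Polarization reduces the product rule to the chain rule for the square. *)
Lemma deriv_along_mult F G x a b :
  deriv_along i F x a -> deriv_along i G x b ->
  deriv_along i (fun y => (F y * G y)%C) x (a * G x + F x * b)%C.
Proof.
  intros HF HG.
  assert (H2 : RtoC 2 <> RtoC 0) by (intros E; injection E; lra).
  replace (a * G x + F x * b)%C
    with (/ 2 * (2 * (F x + G x) * (a + b) - (2 * F x * a + 2 * G x * b)))%C
    by (field; auto).
  apply deriv_along_ext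
    with (fun y => (/ 2 * ((F y + G y) * (F y + G y) - (F y * F y + G y * G y)))%C).
  - intros; field; auto.
  - apply deriv_along_scal. apply deriv_along_minus; [|apply deriv_along_plus].
    + apply (deriv_along_comp (fun z => (z * z)%C) (fun y => (F y + G y)%C)).
      apply cderiv_sqr. now apply deriv_along_plus.
    + apply (deriv_along_comp (fun z => (z * z)%C)); auto. apply cderiv_sqr.
    + apply (deriv_along_comp (fun z => (z * z)%C)); auto. apply cderiv_sqr.
Qed.

Lemma cderiv_Cinv (w : C) : w <> RtoC 0 -> cderiv (fun z => (/ z)%C) w (- / (w * w))%C.
Proof.
  intros Hw eps He.
  assert (Hm : 0 < Cmod w) by now apply Cmod_gt_0.
  set (m := Cmod w) in *.
  assert (H2 : 0 < m * m * m * eps / 2).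
  { assert (0 < m * m * m) by (repeat apply Rmult_lt_0_compat; auto). nra. }
  (* The remainder is exactly [(y - w)^2 / (w^2 y)]. The first radius forces [|y| >= m / 2], the
     second then makes one factor [|y - w|] small enough. *)
  exists (Rmin (m / 2) (m * m * m * eps / 2)); split. apply Rmin_glb_lt; lra.
  intros y Hy.
  pose proof (Rlt_le_trans _ _ _ Hy (Rmin_l _ _)) as Hy1.
  pose proof (Rlt_le_trans _ _ _ Hy (Rmin_r _ _)) as Hy2.
  assert (Hym : m / 2 <= Cmod y).
  { assert (m <= Cmod y + Cmod (y - w)); [|lra].
    unfold m. replace w with (y + - (y - w))%C at 1 by ring.
    eapply Rle_trans; [apply Cmod_triangle|]. rewrite Cmod_opp. lra. }
  assert (Hy0 : y <> RtoC 0). { apply Cmod_gt_0. lra. }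
  replace (/ y - / w - - / (w * w) * (y - w))%C
    with ((y - w) * (y - w) * / (w * w * y))%C by (field; auto).
  rewrite !Cmod_mult.
  rewrite (Rmult_comm eps), Rmult_assoc.
  apply Rmult_le_compat_l; [apply Cmod_ge_0|].
  rewrite Cmod_inv by (repeat apply Cmult_neq_0; auto).
  rewrite !Cmod_mult. fold m.
  assert (0 < m * m) by (apply Rmult_lt_0_compat; auto).
  assert (Hp : 0 < m * m * Cmod y) by (apply Rmult_lt_0_compat; lra).
  apply Rmult_le_reg_r with (m * m * Cmod y); auto.
  rewrite Rmult_assoc, Rinv_l by lra. rewrite Rmult_1_r.
  apply Rle_trans with (m * m * m * eps / 2); [lra|].
  replace (m * m * m * eps / 2) with (eps * (m * m * (m / 2))) by field.
  apply Rmult_le_compat_l; [lra|]. apply Rmult_le_compat_l; lra.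
Qed.

Lemma deriv_along_div F G x a b :
  G x <> RtoC 0 -> deriv_along i F x a -> deriv_along i G x b ->
  deriv_along i (fun y => (F y / G y)%C) x ((a * G x - F x * b) / (G x * G x))%C.
Proof.
  intros H0 HF HG.
  replace ((a * G x - F x * b) / (G x * G x))%C
    with (a * / G x + F x * (- / (G x * G x) * b))%C by (field; auto).
  apply (deriv_along_mult F (fun y => (/ G y)%C)); auto.
  apply (deriv_along_comp (fun z => (/ z)%C)); auto. now apply cderiv_Cinv.
Qed.

End DerivAlong.

Lemma cderiv_continuous (phi : C -> C) z d : cderiv phi z d -> continuous phi z.
Proof.
  intros H. apply continuous_C_Cmod. intros eps He.
  destruct (H 1) as (d1 & Hd1 & H1); [lra|].
  pose proof (Cmod_ge_0 d).
  assert (0 < eps / (Cmod d + 2)) by (apply Rdiv_lt_0_compat; lra).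
  exists (Rmin d1 (eps / (Cmod d + 2))); split. now apply Rmin_glb_lt.
  intros w Hw.
  specialize (H1 w (Rlt_le_trans _ _ _ Hw (Rmin_l _ _))).
  pose proof (Rlt_le_trans _ _ _ Hw (Rmin_r _ _)) as Hw2.
  replace (phi w - phi z)%C with ((phi w - phi z - d * (w - z)) + d * (w - z))%C by ring.
  eapply Rle_lt_trans; [apply Cmod_triangle|]. rewrite Cmod_mult.
  pose proof (Cmod_ge_0 (w - z)%C).
  apply Rle_lt_trans with ((Cmod d + 1) * Cmod (w - z)); [lra|].
  apply Rle_lt_trans with ((Cmod d + 1) * (eps / (Cmod d + 2))).
  - apply Rmult_le_compat_l; lra.
  - replace eps with ((Cmod d + 2) * (eps / (Cmod d + 2))) at 2 by (field; lra).
    apply Rmult_lt_compat_r; lra.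
Qed.

(** * Curve derivatives and real derivatives *)

Lemma im_le_Cmod (c : C) : Rabs (Im c) <= Cmod c.
Proof. eapply Rle_trans; [|apply Rmax_Cmod]. apply Rmax_r. Qed.

Lemma is_derive_R_eps (f : R -> R) t l :
  (forall eps, 0 < eps -> exists del, 0 < del /\ forall s, Rabs (s - t) < del ->
     Rabs (f s - f t - l * (s - t)) <= eps * Rabs (s - t)) ->
  is_derive f t l.
Proof.
  intros H. apply is_derive_Reals. intros eps He.
  (* The limit in [Reals] asks for a strict inequality, hence the halving. *)
  destruct (H (eps / 2)) as (del & Hd & H'); [lra|].
  exists (mkposreal _ Hd). intros k Hk Hkd. simpl in Hkd.
  assert (Hk0 : 0 < Rabs k) by now apply Rabs_pos_lt.
  specialize (H' (t + k)). replace (t + k - t) with k in H' by ring.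
  specialize (H' Hkd).
  replace ((f (t + k) - f t) / k - l) with ((f (t + k) - f t - l * k) / k) by (field; auto).
  unfold Rdiv. rewrite Rabs_mult, Rabs_inv.
  apply Rle_lt_trans with (eps / 2 * Rabs k * / Rabs k).
  - apply Rmult_le_compat_r; auto. now apply Rlt_le, Rinv_0_lt_compat.
  - rewrite Rmult_assoc, Rinv_r; lra.
Qed.

Lemma is_derive_R_eps_inv (f : R -> R) t l :
  is_derive f t l ->
  forall eps, 0 < eps -> exists del, 0 < del /\ forall s, Rabs (s - t) < del ->
     Rabs (f s - f t - l * (s - t)) <= eps * Rabs (s - t).
Proof.
  intros H eps He. apply is_derive_Reals in H. destruct (H eps He) as [del Hd].
  exists del; split; [apply cond_pos|]. intros s Hs.
  destruct (Req_dec s t) as [->|Hne].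
  - replace (f t - f t - l * (t - t)) with 0 by ring. rewrite Rabs_R0.
    apply Rmult_le_pos; [lra|apply Rabs_pos].
  - assert (Hk : s - t <> 0) by lra.
    specialize (Hd (s - t) Hk Hs). replace (t + (s - t)) with s in Hd by ring.
    assert (0 < Rabs (s - t)) by now apply Rabs_pos_lt.
    replace (f s - f t - l * (s - t)) with (((f s - f t) / (s - t) - l) * (s - t))
      by (field; auto).
    rewrite Rabs_mult. apply Rmult_le_compat_r; lra.
Qed.

Lemma curve_deriv_Re F t d : curve_deriv F t d -> is_derive (fun s => Re (F s)) t (Re d).
Proof.
  intros H. apply is_derive_R_eps. intros eps He.
  destruct (H eps He) as (del & Hd & H'). exists del; split; auto.
  intros s Hs. specialize (H' s).
  rewrite <- RtoC_minus, Cmod_R in H'. specialize (H' Hs).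
  eapply Rle_trans; [|apply H']. eapply Rle_trans; [|apply re_le_Cmod].
  right. f_equal. unfold Re, Cminus, Cplus, Copp, Cmult, RtoC; simpl. ring.
Qed.

Lemma curve_deriv_Im F t d : curve_deriv F t d -> is_derive (fun s => Im (F s)) t (Im d).
Proof.
  intros H. apply is_derive_R_eps. intros eps He.
  destruct (H eps He) as (del & Hd & H'). exists del; split; auto.
  intros s Hs. specialize (H' s).
  rewrite <- RtoC_minus, Cmod_R in H'. specialize (H' Hs).
  eapply Rle_trans; [|apply H']. eapply Rle_trans; [|apply im_le_Cmod].
  right. f_equal. unfold Im, Cminus, Cplus, Copp, Cmult, RtoC; simpl. ring.
Qed.

Lemma Cmod_le_Re_Im (z : C) : Cmod z <= Rabs (Re z) + Rabs (Im z).
Proof.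
  replace z with (RtoC (Re z) + Ci * RtoC (Im z))%C at 1.
  - eapply Rle_trans; [apply Cmod_triangle|]. rewrite Cmod_mult, !Cmod_R, Cmod_Ci. lra.
  - destruct z; unfold Re, Im, Ci, RtoC, Cplus, Cmult; simpl. f_equal; ring.
Qed.

Lemma curve_deriv_pair F t d :
  is_derive (fun s => Re (F s)) t (Re d) -> is_derive (fun s => Im (F s)) t (Im d) ->
  curve_deriv F t d.
Proof.
  intros HR HI eps He.
  destruct (is_derive_R_eps_inv _ _ _ HR (eps / 2)) as (d1 & Hd1 & H1); [lra|].
  destruct (is_derive_R_eps_inv _ _ _ HI (eps / 2)) as (d2 & Hd2 & H2); [lra|].
  exists (Rmin d1 d2); split. now apply Rmin_glb_lt.
  intros s Hs. rewrite <- RtoC_minus, Cmod_R in *.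
  specialize (H1 s (Rlt_le_trans _ _ _ Hs (Rmin_l _ _))).
  specialize (H2 s (Rlt_le_trans _ _ _ Hs (Rmin_r _ _))).
  eapply Rle_trans; [apply Cmod_le_Re_Im|].
  replace (Re (F s - F t - d * RtoC (s - t))%C) with (Re (F s) - Re (F t) - Re d * (s - t))
    by (unfold Re, Cminus, Cplus, Copp, Cmult, RtoC; simpl; ring).
  replace (Im (F s - F t - d * RtoC (s - t))%C) with (Im (F s) - Im (F t) - Im d * (s - t))
    by (unfold Im, Cminus, Cplus, Copp, Cmult, RtoC; simpl; ring).
  lra.
Qed.

(** * Cauchy's formula and the Schwarz lemma *)

(** The derivative is carried as a function, so that its continuity, on which Cauchy's formula
    rests, can be stated and followed through quotients and affine changes. *)
Definition holoC1 (r : R) (phi dphi : C -> C) : Prop :=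
  forall z, Cmod z < r -> cderiv phi z (dphi z) /\ continuous dphi z.

Definition circ (th : R) : C := (cos th, sin th).

(** The measure is [d theta]. Since [dw = i w d theta] on the unit circle, Cauchy's kernel
    [dw / (i (w - z))] appears as [circ th / (circ th - z)]. *)
Definition is_Cint (F : R -> C) (I : C) : Prop :=
  is_RInt (fun th => Re (F th)) 0 (2 * PI) (Re I) /\
  is_RInt (fun th => Im (F th)) 0 (2 * PI) (Im I).

Lemma Cmod_circ th : Cmod (circ th) = 1.
Proof.
  unfold Cmod, circ; simpl. pose proof (sin2_cos2 th) as H. unfold Rsqr in H.
  transitivity (sqrt 1); [f_equal; lra|apply sqrt_1].
Qed.

Lemma circ_neq_0 th : circ th <> RtoC 0.
Proof. apply Cmod_gt_0. rewrite Cmod_circ; lra. Qed.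

Lemma circ_2PI : circ (2 * PI) = circ 0.
Proof. unfold circ. now rewrite cos_2PI, sin_2PI, cos_0, sin_0. Qed.

Lemma circ_deriv th : curve_deriv circ th (Ci * circ th)%C.
Proof.
  apply curve_deriv_pair; unfold circ, Ci, Re, Im, Cmult; simpl; auto_derive; auto; ring.
Qed.

Lemma continuous_circ th : continuous circ th.
Proof.
  apply continuous_C_pair; apply (ex_derive_continuous (V := R_NormedModule)); auto_derive; auto.
Qed.

Lemma is_Cint_ext F G I : (forall th, F th = G th) -> is_Cint F I -> is_Cint G I.
Proof.
  intros E [H1 H2]. split.
  - eapply is_RInt_ext; [|apply H1]. intros; simpl; now rewrite E.
  - eapply is_RInt_ext; [|apply H2]. intros; simpl; now rewrite E.
Qed.

Lemma is_Cint_plus F G I J :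
  is_Cint F I -> is_Cint G J -> is_Cint (fun th => (F th + G th)%C) (I + J)%C.
Proof.
  intros [A1 A2] [B1 B2]. split.
  - apply (is_RInt_plus (V := R_NormedModule)); auto.
  - apply (is_RInt_plus (V := R_NormedModule)); auto.
Qed.

Lemma is_Cint_scal c F I : is_Cint F I -> is_Cint (fun th => (c * F th)%C) (c * I)%C.
Proof.
  intros [A1 A2]. split.
  - apply (is_RInt_minus (V := R_NormedModule)
      (fun th => Re c * Re (F th)) (fun th => Im c * Im (F th)));
      apply (is_RInt_scal (V := R_NormedModule)); auto.
  - apply (is_RInt_plus (V := R_NormedModule)
      (fun th => Re c * Im (F th)) (fun th => Im c * Re (F th)));
      apply (is_RInt_scal (V := R_NormedModule)); auto.
Qed.

Lemma is_Cint_const c : is_Cint (fun _ => c) (RtoC (2 * PI) * c)%C.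
Proof.
  split.
  - replace (Re (RtoC (2 * PI) * c)%C) with (scal (2 * PI - 0) (Re c)).
    apply (is_RInt_const (V := R_NormedModule)).
    unfold scal; simpl; unfold mult; simpl; unfold Re, RtoC, Cmult; simpl; ring.
  - replace (Im (RtoC (2 * PI) * c)%C) with (scal (2 * PI - 0) (Im c)).
    apply (is_RInt_const (V := R_NormedModule)).
    unfold scal; simpl; unfold mult; simpl; unfold Im, RtoC, Cmult; simpl; ring.
Qed.

Lemma ex_Cint F : (forall th, continuous F th) -> exists I, is_Cint F I.
Proof.
  intros H.
  exists (RInt (fun th => Re (F th)) 0 (2 * PI), RInt (fun th => Im (F th)) 0 (2 * PI)).
  split; simpl; apply (RInt_correct (V := R_CompleteNormedModule));
    apply (ex_RInt_continuous (V := R_CompleteNormedModule)); intros;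
    [apply continuous_Re|apply continuous_Im]; auto.
Qed.

Lemma is_Cint_periodic_deriv (L F : R -> C) :
  (forall th, curve_deriv L th (F th)) -> (forall th, continuous F th) ->
  L (2 * PI) = L 0 -> is_Cint F (RtoC 0).
Proof.
  intros HL HF HP. split.
  - replace (Re (RtoC 0)) with (minus (Re (L (2 * PI))) (Re (L 0))).
    + apply (is_RInt_derive (V := R_CompleteNormedModule) (fun th => Re (L th))).
      * intros; now apply curve_deriv_Re.
      * intros; now apply continuous_Re.
    + rewrite HP. apply (minus_eq_zero (G := R_AbelianGroup)).
  - replace (Im (RtoC 0)) with (minus (Im (L (2 * PI))) (Im (L 0))).
    + apply (is_RInt_derive (V := R_CompleteNormedModule) (fun th => Im (L th))).
      * intros; now apply curve_deriv_Im.
      * intros; now apply continuous_Im.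
    + rewrite HP. apply (minus_eq_zero (G := R_AbelianGroup)).
Qed.

(** Differentiation under the integral sign gives derivative 0 in [t]. The margin [del] makes
    two-sided derivatives available at the endpoints 0 and 1. *)
Lemma RInt_homotopy_const (G Gt : R -> R -> R) (a b del : R) :
  0 < del ->
  (forall t th, - del < t < 1 + del -> is_derive (fun s => G s th) t (Gt t th)) ->
  (forall t th, - del < t < 1 + del ->
     continuous (fun p : R * R => Gt (fst p) (snd p)) (t, th)) ->
  (forall t th, - del < t < 1 + del -> continuous (G t) th) ->
  (forall t, 0 <= t <= 1 -> is_RInt (Gt t) a b 0) ->
  RInt (G 0) a b = RInt (G 1) a b.
Proof.
  intros Hdel HD HC HG HI.
  assert (Hloc : forall t, 0 <= t <= 1 -> locally t (fun s => - del < s < 1 + del)).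
  { intros t Ht. exists (mkposreal _ Hdel). intros s Hs.
    change (Rabs (s - t) < del) in Hs. apply Rabs_def2 in Hs. lra. }
  apply (eq_is_derive (V := R_NormedModule) (fun t => RInt (G t) a b)); [|lra].
  intros t Ht.
  assert (E : RInt (fun th => Derive (fun s => G s th) t) a b = 0).
  { rewrite <- (is_RInt_unique (V := R_CompleteNormedModule) _ _ _ _ (HI t Ht)).
    apply RInt_ext. intros th _. apply is_derive_unique, HD. lra. }
  change (is_derive (fun t0 => RInt (G t0) a b) t 0). rewrite <- E.
  apply is_derive_RInt_param.
  - generalize (Hloc t Ht). apply filter_imp. intros s Hs th _. eexists. now apply HD.
  - intros th _. apply continuity_2d_pt_ext_loc with Gt.
    + exists (mkposreal _ Hdel). intros u v Hu _. simpl in Hu. apply Rabs_def2 in Hu.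
      symmetry. apply is_derive_unique, HD. lra.
    + apply continuity_2d_pt_filterlim. apply (HC t th). lra.
  - generalize (Hloc t Ht). apply filter_imp. intros s Hs.
    apply (ex_RInt_continuous (V := R_CompleteNormedModule)). intros; now apply HG.
Qed.

Lemma Cint_homotopy_const (G Gt : R -> R -> C) (del : R) I J :
  0 < del ->
  (forall t th, - del < t < 1 + del -> curve_deriv (fun s => G s th) t (Gt t th)) ->
  (forall t th, - del < t < 1 + del ->
     continuous (fun p : R * R => Gt (fst p) (snd p)) (t, th)) ->
  (forall t th, - del < t < 1 + del -> continuous (G t) th) ->
  (forall t, 0 <= t <= 1 -> is_Cint (Gt t) (RtoC 0)) ->
  is_Cint (G 0) I -> is_Cint (G 1) J -> I = J.
Proof.
  intros Hdel HD HC HG HI [I1 I2] [J1 J2].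
  apply (is_RInt_unique (V := R_CompleteNormedModule)) in I1, I2, J1, J2.
  destruct I as [a b], J as [c d]; simpl in *. f_equal.
  - rewrite <- I1, <- J1.
    apply RInt_homotopy_const with (Gt := fun t th => Re (Gt t th)) (del := del) (G := fun t th => Re (G t th)); auto.
    + intros; now apply curve_deriv_Re, HD.
    + intros; now apply (continuous_Re (fun p : R * R => Gt (fst p) (snd p))), HC.
    + intros; now apply continuous_Re, HG.
    + intros t Ht. exact (proj1 (HI t Ht)).
  - rewrite <- I2, <- J2.
    apply RInt_homotopy_const with (Gt := fun t th => Im (Gt t th)) (del := del) (G := fun t th => Im (G t th)); auto.
    + intros; now apply curve_deriv_Im, HD.
    + intros; now apply (continuous_Im (fun p : R * R => Gt (fst p) (snd p))), HC.
    + intros; now apply continuous_Im, HG.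
    + intros t Ht. exact (proj2 (HI t Ht)).
Qed.

(* Cauchy's formula up to the value [c] of the kernel integral: the circle is
   contracted to [z], and the integral does not change because its derivative in
   the contraction parameter [t] is the integral of an exact differential. *)
Lemma cauchy_formula (r : R) (phi dphi : C -> C) (z c : C) :
  1 < r -> holoC1 r phi dphi -> Cmod z < 1 ->
  is_Cint (fun th => circ th / (circ th - z))%C c ->
  is_Cint (fun th => phi (circ th) * (circ th / (circ th - z)))%C (phi z * c)%C.
Proof.
  intros Hr Hphi Hz Hc.
  assert (Hne : forall th, (circ th - z)%C <> RtoC 0).
  { intros th E. assert (circ th = z) by (rewrite <- (Cplus_0_l z), <- E; ring).
    pose proof (Cmod_circ th). rewrite H in H0. lra. }
  (* For [t] within [del] of [[0, 1]] the contracted point has modulus at most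
     [|1 - t| + |t| < 1 + 2 del = r]. *)
  set (del := (r - 1) / 2). assert (Hdel : 0 < del) by (unfold del; lra).
  assert (Hin : forall t th, - del < t < 1 + del -> Cmod (z + RtoC t * (circ th - z))%C < r).
  { intros t th Ht.
    replace (z + RtoC t * (circ th - z))%C with (RtoC (1 - t) * z + RtoC t * circ th)%C
      by (rewrite RtoC_minus; ring).
    eapply Rle_lt_trans; [apply Cmod_triangle|].
    rewrite !Cmod_mult, !Cmod_R, Cmod_circ. pose proof (Cmod_ge_0 z).
    assert (Rabs (1 - t) * Cmod z <= Rabs (1 - t)) by (pose proof (Rabs_pos (1 - t)); nra).
    unfold del in Ht.
    unfold Rabs in *; destruct (Rcase_abs t), (Rcase_abs (1 - t)); lra. }
  set (G := fun t th => (phi (z + RtoC t * (circ th - z)) * (circ th / (circ th - z)))%C).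
  (* The chain-rule factor [circ th - z] cancels the denominator of the kernel, so the
     [t]-derivative has no singular factor left. *)
  set (Gt := fun t th => (dphi (z + RtoC t * (circ th - z)) * circ th)%C).
  assert (Hker : forall th, continuous (fun th => circ th / (circ th - z))%C th).
  { intros th. apply continuous_Cdiv; auto. apply continuous_circ.
    apply continuous_Cminus. apply continuous_circ. apply continuous_Cconst. }
  assert (HG : forall t th, - del < t < 1 + del -> continuous (G t) th).
  { intros t th Ht. apply continuous_Cmult; auto.
    apply (continuous_comp (fun th => z + RtoC t * (circ th - z))%C phi).
    - apply continuous_Cplus. apply continuous_Cconst.
      apply continuous_Cmult. apply continuous_Cconst.
      apply continuous_Cminus. apply continuous_circ. apply continuous_Cconst.
    - destruct (Hphi _ (Hin t th Ht)) as [H _]. eapply cderiv_continuous; eauto. }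
  assert (HGt : forall t th, - del < t < 1 + del ->
     continuous (fun p : R * R => Gt (fst p) (snd p)) (t, th)).
  { intros t th Ht.
    assert (Hcc : continuous (fun p : R * R => circ (snd p)) (t, th)).
    { apply (continuous_comp (fun p : R * R => snd p) circ).
      apply continuous_snd. apply continuous_circ. }
    apply continuous_Cmult; auto.
    apply (continuous_comp (fun p : R * R => z + RtoC (fst p) * (circ (snd p) - z))%C dphi).
    - apply continuous_Cplus. apply continuous_Cconst.
      apply continuous_Cmult.
      + apply continuous_C_pair. apply continuous_fst. apply continuous_const.
      + apply continuous_Cminus; auto. apply continuous_Cconst.
    - simpl. apply (Hphi _ (Hin t th Ht)). }
  assert (HGt1 : forall t th, - del < t < 1 + del -> continuous (Gt t) th).
  { intros t th Ht. apply (continuous_comp (fun th => (t, th) : R * R) (fun p : R * R => Gt (fst p) (snd p))).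
    - apply (continuous_C_pair (fun _ => t) (fun th => th)). apply continuous_const. apply continuous_id.
    - now apply HGt. }
  assert (HJ : exists J, is_Cint (G 1) J).
  { apply ex_Cint. intros th. apply HG. lra. }
  destruct HJ as [J HJ].
  assert (E : (phi z * c)%C = J).
  { apply (Cint_homotopy_const G Gt del (phi z * c)%C J); auto.
    - intros t th Ht. unfold G, Gt.
      replace (dphi (z + RtoC t * (circ th - z)) * circ th)%C
        with ((circ th / (circ th - z)) * (dphi (z + RtoC t * (circ th - z)) * (0 + (1 * (circ th - z) + RtoC t * 0))))%C
        by (field; auto).
      apply deriv_along_ext with (fun s => (circ th / (circ th - z) * phi (z + RtoC s * (circ th - z)))%C).
      { intros; ring. }
      apply deriv_along_scal.
      apply (deriv_along_comp RtoC phi (fun s => (z + RtoC s * (circ th - z))%C)).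
      + apply (Hphi _ (Hin t th Ht)).
      + apply deriv_along_plus. apply deriv_along_const.
        apply (deriv_along_mult RtoC RtoC (fun _ => (circ th - z)%C)).
        apply deriv_along_id. apply deriv_along_const.
    (* For [t <> 0] a primitive in [th] is [phi / (i t)] along the contracted circle. At [t = 0]
       that circle is a point, and [circ / i] serves as primitive of the remaining factor. *)
    - intros t Ht. destruct (Req_dec t 0) as [->|Hn].
      + apply is_Cint_ext with (fun th => (dphi z * circ th)%C).
        { intros th. unfold Gt. do 2 f_equal. ring. }
        replace (RtoC 0) with (dphi z * 0)%C by ring. apply is_Cint_scal.
        apply (is_Cint_periodic_deriv (fun th => / Ci * circ th)%C).
        * intros th. pose proof (deriv_along_scal RtoC (/ Ci)%C circ th _ (circ_deriv th)) as Hd.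
          replace (/ Ci * (Ci * circ th))%C with (circ th) in Hd by (field; apply Ci_nz).
          exact Hd.
        * intros; apply continuous_circ.
        * now rewrite circ_2PI.
      + assert (Hc0 : (Ci * RtoC t)%C <> RtoC 0).
        { apply Cmult_neq_0. apply Ci_nz. intros E; injection E; auto. }
        apply (is_Cint_periodic_deriv (fun th => / (Ci * RtoC t) * phi (z + RtoC t * (circ th - z)))%C).
        * intros th. unfold Gt.
          replace (dphi (z + RtoC t * (circ th - z)) * circ th)%C
            with (/ (Ci * RtoC t) * (dphi (z + RtoC t * (circ th - z)) * (0 + RtoC t * (Ci * circ th - 0))))%C.
          2:{ field. split. intros E; injection E; auto. apply Ci_nz. }
          apply deriv_along_scal.
          apply (deriv_along_comp RtoC phi (fun th => (z + RtoC t * (circ th - z))%C)).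
          { apply Hphi, Hin. lra. }
          apply deriv_along_plus. apply deriv_along_const.
          apply deriv_along_scal. apply deriv_along_minus. apply circ_deriv. apply deriv_along_const.
        * intros; apply HGt1. lra.
        * now rewrite circ_2PI.
    - apply is_Cint_ext with (fun th => (phi z * (circ th / (circ th - z)))%C).
      + intros th. unfold G. do 2 f_equal. ring.
      + now apply is_Cint_scal. }
  rewrite E. eapply is_Cint_ext; [|apply HJ].
  intros th. unfold G. do 2 f_equal. ring.
Qed.

(** At the centre the Cauchy kernel is identically 1, so the constant of [cauchy_formula] is known
    to be [2 * PI]. *)
Lemma mean_value (r : R) (phi dphi : C -> C) :
  1 < r -> holoC1 r phi dphi -> is_Cint (fun th => phi (circ th)) (phi (RtoC 0) * RtoC (2 * PI))%C.
Proof.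
  intros Hr H.
  assert (E : forall th, (circ th / (circ th - 0))%C = RtoC 1).
  { intros th. field. replace (circ th - 0)%C with (circ th) by ring. apply circ_neq_0. }
  apply is_Cint_ext with (fun th => phi (circ th) * (circ th / (circ th - 0)))%C.
  - intros th. rewrite E. ring.
  - apply cauchy_formula with r dphi; auto. rewrite Cmod_0; lra.
    apply is_Cint_ext with (fun _ => RtoC 1). auto.
    replace (RtoC (2 * PI)) with (RtoC (2 * PI) * 1)%C by ring. apply is_Cint_const.
Qed.

Lemma holoC1_div r phi dphi psi dpsi :
  holoC1 r phi dphi -> holoC1 r psi dpsi ->
  (forall z, Cmod z < r -> psi z <> RtoC 0) ->
  holoC1 r (fun z => phi z / psi z)%C
    (fun z => (dphi z * psi z - phi z * dpsi z) / (psi z * psi z))%C.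
Proof.
  intros H1 H2 H0 z Hz. destruct (H1 z Hz) as [D1 C1], (H2 z Hz) as [D2 C2].
  assert (K1 : continuous phi z) by (eapply cderiv_continuous; eauto).
  assert (K2 : continuous psi z) by (eapply cderiv_continuous; eauto).
  split. apply deriv_along_div; auto.
  apply continuous_Cdiv.
  - apply continuous_Cminus; apply continuous_Cmult; auto.
  - apply continuous_Cmult; auto.
  - apply Cmult_neq_0; auto.
Qed.

Lemma holoC1_affine r phi dphi a b :
  holoC1 r phi dphi -> holoC1 r (fun z => a + b * phi z)%C (fun z => b * dphi z)%C.
Proof.
  intros H z Hz. destruct (H z Hz) as [D1 C1]. split.
  - replace (b * dphi z)%C with (0 + b * dphi z)%C by ring.
    apply deriv_along_plus. apply deriv_along_const. now apply deriv_along_scal.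
  - apply continuous_Cmult; auto. apply continuous_Cconst.
Qed.

Lemma holoC1_id r : holoC1 r (fun z => z) (fun _ => RtoC 1).
Proof. intros z _. split. apply deriv_along_id. apply continuous_Cconst. Qed.

Lemma unimodular_rotation (I : C) : exists u, Cmod u = 1 /\ (u * I)%C = RtoC (Cmod I).
Proof.
  destruct (Req_dec (Cmod I) 0) as [E|E].
  - exists (RtoC 1). split. apply Cmod_1. rewrite E. rewrite (Cmod_eq_0 _ E). ring.
  - assert (Hn : RtoC (Cmod I) <> RtoC 0) by (intros Q; injection Q; auto).
    pose proof (Cmod_ge_0 I).
    exists (Cconj I / RtoC (Cmod I))%C. split.
    + rewrite Cmod_div, Cmod_conj, Cmod_R, Rabs_pos_eq by auto. field; lra.
    + transitivity ((I * Cconj I) / RtoC (Cmod I))%C; [field; auto|].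
      rewrite <- Cmod2_conj, RtoC_pow. field; auto.
Qed.

(** Rotating the integral onto the positive axis reduces the triangle inequality for integrals to
    monotonicity of a real one. *)
Lemma Cmod_is_Cint_le F (p : R -> R) I m :
  (forall th, Cmod (F th) <= p th) -> is_Cint F I -> is_RInt p 0 (2 * PI) m -> Cmod I <= m.
Proof.
  intros HF HI Hp. destruct (unimodular_rotation I) as (u & Hu & HuI).
  destruct (is_Cint_scal u F I HI) as [HR _]. rewrite HuI in HR. simpl in HR.
  eapply (is_RInt_le (fun th => Re (u * F th)%C) p 0 (2 * PI)); eauto.
  - pose proof PI_RGT_0; lra.
  - intros th _. eapply Rle_trans; [apply Rle_abs|].
    eapply Rle_trans; [apply re_le_Cmod|]. rewrite Cmod_mult, Hu, Rmult_1_l. apply HF.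
Qed.

(* Cauchy's kernel may be replaced by [z / gamma] times the Poisson kernel,
   the difference being annihilated by holomorphic functions vanishing at 0. *)
Lemma schwarz_unit (r : R) (om dom : C -> C) (M : R) (z : C) :
  1 < r -> holoC1 r om dom -> om (RtoC 0) = RtoC 0 ->
  (forall w, Cmod w = 1 -> Cmod (om w) <= M) -> Cmod z < 1 ->
  Cmod (om z) <= M * Cmod z.
Proof.
  intros Hr Hom H0 HM Hz.
  pose proof (Cmod_ge_0 z) as Hz0.
  assert (Hne : forall th, (circ th - z)%C <> RtoC 0).
  { intros th E. assert (circ th = z) by (rewrite <- (Cplus_0_l z), <- E; ring).
    pose proof (Cmod_circ th). rewrite H in H1. lra. }
  (* A radius above 1 on which [1 - conj z * w] has no zero: [2 / (1 + |z|)] lies below [1 / |z|]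
     and still makes sense at [z = 0]. *)
  set (r' := Rmin r (2 / (1 + Cmod z))).
  assert (Hr1 : 1 < r').
  { apply Rmin_glb_lt; auto. apply Rmult_lt_reg_r with (1 + Cmod z). lra.
    unfold Rdiv; rewrite Rmult_assoc, Rinv_l; lra. }
  assert (Hz1 : forall w, Cmod w < r' -> (1 + (- Cconj z) * w)%C <> RtoC 0).
  { intros w Hw E.
    assert (E1 : (Cconj z * w)%C = RtoC 1).
    { replace (Cconj z * w)%C with (1 - (1 + (- Cconj z) * w))%C by ring. rewrite E. ring. }
    assert (E2 : Cmod z * Cmod w = 1).
    { rewrite <- (Cmod_conj z), <- Cmod_mult, E1. apply Cmod_1. }
    assert (Hw2 : Cmod w < 2 / (1 + Cmod z)) by (eapply Rlt_le_trans; [apply Hw|apply Rmin_r]).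
    apply (Rmult_lt_compat_r (1 + Cmod z)) in Hw2; [|lra].
    unfold Rdiv in Hw2; rewrite Rmult_assoc, Rinv_l in Hw2 by lra.
    assert (1 < Cmod w); [|lra]. pose proof (Cmod_ge_0 w). nra. }
  assert (Hom' : holoC1 r' om dom).
  { intros w Hw. apply Hom. eapply Rlt_le_trans; [apply Hw|apply Rmin_l]. }
  pose proof (holoC1_affine r' _ _ (RtoC 1) (- Cconj z)%C (holoC1_id r')) as Hden.
  pose proof (holoC1_div _ _ _ _ _ Hom' Hden Hz1) as Hq.
  (* The numerator [1 + 0 * w] is the constant 1, so this treats [1 / (1 - conj z * w)]. *)
  pose proof (holoC1_div _ _ _ _ _ (holoC1_affine r' _ _ (RtoC 1) (RtoC 0) (holoC1_id r')) Hden Hz1) as Hq1.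
  apply mean_value in Hq; auto. apply mean_value in Hq1; auto.
  pose proof (mean_value _ _ _ Hr1 Hom') as Hq2.
  assert (Hexc : exists c, is_Cint (fun th => circ th / (circ th - z))%C c).
  { apply ex_Cint. intros th. apply continuous_Cdiv; auto. apply continuous_circ.
    apply continuous_Cminus. apply continuous_circ. apply continuous_Cconst. }
  destruct Hexc as [c Hc].
  pose proof (cauchy_formula r om dom z c Hr Hom Hz Hc) as Hcf.
  set (P := fun th => (1 - Cmod z ^ 2) / Cmod (circ th - z)%C ^ 2).
  assert (HPpos : forall th, 0 < P th).
  { intros th. apply Rdiv_lt_0_compat. nra.
    apply pow_lt. now apply Cmod_gt_0. }
  (* On the unit circle [conj w = 1 / w], which splits the Poisson kernel into the Cauchy kernel,
     its reflection [1 / (1 - conj z * w)], and [-1]. *)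
  assert (HPC : forall th, RtoC (P th) =
     (circ th / (circ th - z) + ((1 + 0 * circ th) / (1 + - Cconj z * circ th) + - (1)))%C).
  { intros th. unfold P.
    pose proof (circ_neq_0 th) as Hg.
    assert (Hgb : Cconj (circ th) = (/ circ th)%C).
    { transitivity (circ th * Cconj (circ th) * / circ th)%C; [field; auto|].
      rewrite <- Cmod2_conj, Cmod_circ, pow1. ring. }
    assert (Hd1 : (1 + - Cconj z * circ th)%C <> RtoC 0) by (apply Hz1; rewrite Cmod_circ; auto).
    rewrite RtoC_div by (apply pow_nonzero, Rgt_not_eq, Cmod_gt_0, Hne).
    rewrite RtoC_minus, !Cmod2_conj, Cminus_conj, Hgb.
    specialize (Hne th). field. repeat split; auto. }
  (* The reflected kernel equals 1 at the origin, so its mean value cancels the constant [-1] and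
     only [c] remains. *)
  assert (HPint : is_Cint (fun th => RtoC (P th)) c).
  { apply is_Cint_ext with (1 := fun th => eq_sym (HPC th)).
    replace c with (c + ((1 + 0 * 0) / (1 + - Cconj z * 0) * RtoC (2 * PI) + RtoC (2 * PI) * - (1)))%C.
    - apply is_Cint_plus; auto. apply is_Cint_plus; auto. apply is_Cint_const.
    - field. }
  destruct HPint as [HP1 HP2]. simpl in HP1, HP2.
  (* Being the integral of a real positive function, [c] is real and positive; this is all that is
     needed to divide by it at the end. *)
  assert (Ec : c = RtoC (Re c)).
  { destruct c as [c1 c2]; simpl in *. unfold RtoC. f_equal.
    apply (is_RInt_unique (V := R_CompleteNormedModule)) in HP2. rewrite <- HP2.
    rewrite (RInt_const (V := R_CompleteNormedModule)). apply Rmult_0_r. }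
  assert (Hcpos : 0 < Re c).
  { rewrite <- (is_RInt_unique (V := R_CompleteNormedModule) _ _ _ _ HP1). apply RInt_gt_0.
    - pose proof PI_RGT_0; lra.
    - auto.
    - intros th _. apply (continuous_ext (fun th => Re (RtoC (P th)))). auto.
      apply continuous_Re.
      apply (continuous_ext (fun th => (circ th / (circ th - z) + ((1 + 0 * circ th) / (1 + - Cconj z * circ th) + - (1)))%C)).
      { intros; now rewrite HPC. }
      pose proof (continuous_circ th).
      apply continuous_Cplus; [|apply continuous_Cplus; [|apply continuous_Cconst]].
      + apply continuous_Cdiv; auto. apply continuous_Cminus; auto. apply continuous_Cconst.
      + apply continuous_Cdiv.
        * apply continuous_Cplus; [apply continuous_Cconst|].
          apply continuous_Cmult; auto. apply continuous_Cconst.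
        * apply continuous_Cplus; [apply continuous_Cconst|].
          apply continuous_Cmult; auto. apply continuous_Cconst.
        * apply Hz1. rewrite Cmod_circ; auto. }
  (* Here [(z / w) P = w / (w - z) - 1 + |z|^2 / (1 - conj z * w)]. Multiplied by [om], the last two
     terms have mean value 0 because [om] vanishes at 0. The factor [|z / w| = |z|] is the gain in
     Schwarz's lemma. *)
  assert (HF : is_Cint (fun th => om (circ th) * (z / circ th) * RtoC (P th))%C (om z * c)%C).
  { rewrite H0 in Hq, Hq2.
    replace (om z * c)%C with (om z * c + ((- (1)) * (0 * RtoC (2 * PI)) +
       (z * Cconj z) * (0 / (1 + - Cconj z * 0) * RtoC (2 * PI))))%C
      by (unfold Cdiv; ring).
    eapply is_Cint_ext; [|apply is_Cint_plus; [apply Hcf|apply is_Cint_plus;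
      [apply is_Cint_scal, Hq2|apply is_Cint_scal, Hq]]].
    intros th. simpl. rewrite HPC. pose proof (circ_neq_0 th). specialize (Hne th).
    assert (Hd1 : (1 + - Cconj z * circ th)%C <> RtoC 0) by (apply Hz1; rewrite Cmod_circ; auto).
    field. repeat split; auto. }
  assert (Hle : Cmod (om z * c)%C <= M * Cmod z * Re c).
  { apply Cmod_is_Cint_le with (2 := HF) (p := fun th => M * Cmod z * P th).
    2: apply (is_RInt_scal (V := R_NormedModule)), HP1.
    intros th. cbv beta. rewrite !Cmod_mult, Cmod_div, Cmod_circ, Cmod_R by apply circ_neq_0.
    specialize (HPpos th). rewrite Rabs_pos_eq by lra.
    apply Rmult_le_compat_r; [lra|]. unfold Rdiv. rewrite Rinv_1, Rmult_1_r.
    apply Rmult_le_compat_r; auto. apply HM, Cmod_circ. }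
  rewrite Ec, Cmod_mult, Cmod_R, Rabs_pos_eq in Hle by lra. simpl in Hle.
  now apply Rmult_le_reg_r in Hle.
Qed.

(** [schwarz_unit] wants holomorphy beyond the unit circle, so it is applied to [w |-> om (s w)] for
    every [s < rho]; then [s] tends to [rho]. *)
Lemma schwarz (rho : R) (om dom : C -> C) (M : R) (z : C) :
  holoC1 rho om dom -> om (RtoC 0) = RtoC 0 ->
  (forall w, Cmod w < rho -> Cmod (om w) <= M) -> Cmod z < rho ->
  rho * Cmod (om z) <= M * Cmod z.
Proof.
  intros Hom H0 HM Hz. pose proof (Cmod_ge_0 z) as Hz0.
  assert (Hs : forall s, Cmod z < s < rho -> s * Cmod (om z) <= M * Cmod z).
  { intros s Hs. assert (Hs0 : RtoC s <> RtoC 0) by (intros E; injection E; lra).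
    assert (Hm : forall w, Cmod (RtoC s * w) = s * Cmod w).
    { intros w. rewrite Cmod_mult, Cmod_R, Rabs_pos_eq; lra. }
    assert (Hzs : Cmod (z / RtoC s) = Cmod z / s).
    { rewrite Cmod_div, Cmod_R, Rabs_pos_eq by (auto; lra). auto. }
    assert (Hin : forall w, Cmod w < rho / s -> Cmod (RtoC s * w) < rho).
    { intros w Hw. rewrite Hm. apply (Rmult_lt_compat_l s) in Hw; [|lra].
      replace (s * (rho / s)) with rho in Hw by (field; lra). auto. }
    assert (H : Cmod (om (RtoC s * (z / RtoC s))%C) <= M * Cmod (z / RtoC s)%C).
    { apply (schwarz_unit (rho / s) (fun w => om (RtoC s * w)%C) (fun w => (dom (RtoC s * w) * RtoC s)%C)).
      - apply Rmult_lt_reg_r with s. lra. unfold Rdiv. rewrite Rmult_assoc, Rinv_l; lra.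
      - intros w Hw. destruct (Hom _ (Hin w Hw)) as [D Cn]. split.
        + apply (deriv_along_comp (fun z => z) om (fun w => (RtoC s * w)%C)); auto.
          apply cderiv_Cmult_l.
        + apply continuous_Cmult; [|apply continuous_Cconst].
          apply (continuous_comp (fun w => (RtoC s * w)%C) dom); auto.
          eapply cderiv_continuous, cderiv_Cmult_l.
      - rewrite Cmult_0_r. auto.
      - intros w Hw. apply HM. rewrite Hm, Hw. lra.
      - rewrite Hzs. apply Rmult_lt_reg_r with s. lra. unfold Rdiv. rewrite Rmult_assoc, Rinv_l; lra. }
    replace (RtoC s * (z / RtoC s))%C with z in H by (field; auto).
    rewrite Hzs in H. apply (Rmult_le_compat_l s) in H; [|lra].
    replace (s * (M * (Cmod z / s))) with (M * Cmod z) in H by (field; lra). auto. }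
  destruct (Rle_dec (rho * Cmod (om z)) (M * Cmod z)) as [|Hn]; auto.
  exfalso. apply Rnot_le_lt in Hn.
  pose proof (Cmod_ge_0 (om z)) as Ho.
  set (d := rho * Cmod (om z) - M * Cmod z) in *.
  (* The midpoint keeps [s] above [|z|]; the other entry makes the loss [(rho - s) |om z|] at most
     half of the assumed excess [d]. *)
  set (s := Rmax ((Cmod z + rho) / 2) (rho - d / (2 * (Cmod (om z) + 1)))).
  assert (Hd : 0 < d) by (unfold d; lra).
  assert (He : 0 < d / (2 * (Cmod (om z) + 1))) by (apply Rdiv_lt_0_compat; lra).
  assert (Hs1 : Cmod z < s < rho).
  { split.
    - eapply Rlt_le_trans; [|apply Rmax_l]. lra.
    - apply Rmax_lub_lt; lra. }
  specialize (Hs s Hs1).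
  assert (Hs2 : rho - d / (2 * (Cmod (om z) + 1)) <= s) by apply Rmax_r.
  assert (d / (2 * (Cmod (om z) + 1)) * Cmod (om z) <= d / 2).
  { replace (d / 2) with (d / (2 * (Cmod (om z) + 1)) * (Cmod (om z) + 1)) by (field; lra).
    apply Rmult_le_compat_l; lra. }
  unfold d in *. nra.
Qed.

(** * Holomorphy of the Wirtinger derivatives *)

Lemma is_derive_cderiv (h : C -> C) (z l : C) :
  is_derive (K := C_AbsRing) (V := C_NormedModule) h z l -> cderiv h z l.
Proof.
  intros [_ H] eps He.
  specialize (H z (fun P HP => HP) (mkposreal _ He)).
  destruct H as [d H].
  exists d; split; [apply cond_pos|]. intros y Hy. specialize (H y Hy).
  unfold minus, plus, opp, scal in H; simpl in H; unfold mult, norm in H; simpl in H.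
  replace (h y - h z - l * (y - z))%C with (h y + - h z + - ((y + - z) * l))%C by ring.
  exact H.
Qed.

Lemma unit_disk_Cmod (z : C) : unit_disk z <-> Cmod z < 1.
Proof. unfold unit_disk, disk. replace (z - 0)%C with z by ring. tauto. Qed.

Lemma analytic_cderiv (h : C -> C) (z : C) :
  analytic h -> Cmod z < 1 -> cderiv h z (C_derive h z).
Proof.
  intros H Hz. apply is_derive_cderiv, C_derive_correct; auto.
  apply H. now apply unit_disk_Cmod.
Qed.

Lemma disk_nbhd (r : R) (z w : C) : Cmod (w - z) < r - Cmod z -> Cmod w < r.
Proof.
  intros H. replace w with ((w - z) + z)%C by ring.
  eapply Rle_lt_trans; [apply Cmod_triangle|]. lra.
Qed.

Lemma curve_deriv_conj (F : R -> C) t d :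
  curve_deriv F t d -> curve_deriv (fun s => Cconj (F s)) t (Cconj d).
Proof.
  intros H eps He. destruct (H eps He) as (del & Hd & H'). exists del; split; auto.
  intros s Hs. specialize (H' s Hs). rewrite <- Cmod_conj in H'.
  eapply Rle_trans; [|apply H']. right. f_equal.
  unfold Cconj, Cminus, Cplus, Copp, Cmult, RtoC; simpl. f_equal; ring.
Qed.

Lemma curve_deriv_hline (x y : R) : curve_deriv (fun s => (s, y) : C) x (RtoC 1).
Proof. apply curve_deriv_pair; simpl; auto_derive; auto. Qed.

Lemma curve_deriv_vline (x y : R) : curve_deriv (fun s => (x, s) : C) y Ci.
Proof. apply curve_deriv_pair; simpl; auto_derive; auto. Qed.

Lemma pdx_unique f z d : curve_deriv (fun x => f (x, Im z)) (Re z) d -> pdx f z = d.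
Proof.
  intros H. unfold pdx. rewrite (surjective_pairing d). f_equal; apply is_derive_unique.
  - now apply curve_deriv_Re in H.
  - now apply curve_deriv_Im in H.
Qed.

Lemma pdy_unique f z d : curve_deriv (fun y => f (Re z, y)) (Im z) d -> pdy f z = d.
Proof.
  intros H. unfold pdy. rewrite (surjective_pairing d). f_equal; apply is_derive_unique.
  - now apply curve_deriv_Re in H.
  - now apply curve_deriv_Im in H.
Qed.

Lemma pdx_correct f z : ex_pdx f z -> curve_deriv (fun x => f (x, Im z)) (Re z) (pdx f z).
Proof. intros [H1 H2]. apply curve_deriv_pair; now apply Derive_correct. Qed.

Lemma pdy_correct f z : ex_pdy f z -> curve_deriv (fun y => f (Re z, y)) (Im z) (pdy f z).
Proof. intros [H1 H2]. apply curve_deriv_pair; now apply Derive_correct. Qed.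

Lemma Re_Im_pair (z : C) : (Re z, Im z) = z.
Proof. now destruct z. Qed.

(** Total differentiability from one partial derivative continuous at the point. The asymmetry lets
    the Cauchy-Riemann criterion assume continuity of the [x]-derivative alone. *)
Lemma is_derive_differentiable (u : R -> R -> R) (ux : C -> R) (uy : R) (z : C) (r : R) :
  Cmod z < r ->
  (forall w : C, Cmod w < r -> is_derive (fun x => u x (Im w)) (Re w) (ux w)) ->
  is_derive (fun y => u (Re z) y) (Im z) uy ->
  continuous ux z ->
  forall eps, 0 < eps -> exists d, 0 < d /\ forall w, Cmod (w - z) < d ->
    Rabs (u (Re w) (Im w) - u (Re z) (Im z) - (ux z * Re (w - z)%C + uy * Im (w - z)%C))
      <= eps * Cmod (w - z).
Proof.
  intros Hz Hx Hy Hc eps He. destruct z as [x y].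
  assert (HF : differentiable_pt_lim u x y (ux (x, y)) uy).
  { apply filterdiff_differentiable_pt_lim.
    apply (is_derive_filterdiff u x y (fun a b => ux (a, b)) uy).
    - apply locally_C_Cmod. exists (r - Cmod (x, y)); split; [lra|].
      intros [a b] Hw. apply disk_nbhd in Hw. apply (Hx (a, b) Hw).
    - apply Hy.
    - eapply continuous_ext; [|apply Hc]. now intros [? ?]. }
  specialize (HF (mkposreal _ He)). destruct HF as [d Hd].
  exists d; split; [apply cond_pos|]. intros [a b] Hw.
  pose proof (Rmax_Cmod ((a, b) - (x, y))%C) as HM. simpl in HM.
  pose proof (Rmax_l (Rabs (a + - x)) (Rabs (b + - y))).
  pose proof (Rmax_r (Rabs (a + - x)) (Rabs (b + - y))).
  assert (Ha : Rabs (a - x) < d) by (unfold Rminus; lra).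
  assert (Hb : Rabs (b - y) < d) by (unfold Rminus; lra).
  specialize (Hd a b Ha Hb). simpl in Hd. simpl.
  unfold Rminus in *.
  eapply Rle_trans; [apply Hd|]. apply Rmult_le_compat_l; lra.
Qed.

(** The Cauchy-Riemann equations in the form [W_y = i W_x]: the linear parts of [Re W] and [Im W]
    then assemble into multiplication by [Wx z]. *)
Lemma cauchy_riemann_cderiv (W Wx : C -> C) (z : C) (r : R) :
  Cmod z < r ->
  (forall w, Cmod w < r -> curve_deriv (fun x => W (x, Im w)) (Re w) (Wx w)) ->
  curve_deriv (fun y => W (Re z, y)) (Im z) (Ci * Wx z)%C ->
  continuous Wx z -> cderiv W z (Wx z).
Proof.
  intros Hz Hx Hy Hc eps He.
  assert (He2 : 0 < eps / 2) by lra.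
  destruct (is_derive_differentiable (fun x y => Re (W (x, y))) (fun w => Re (Wx w))
    (Re (Ci * Wx z)%C) z r Hz) with (eps := eps / 2) as (d1 & Hd1 & H1); auto.
  { intros w Hw. exact (curve_deriv_Re _ _ _ (Hx w Hw)). }
  { exact (curve_deriv_Re _ _ _ Hy). }
  { now apply continuous_Re. }
  destruct (is_derive_differentiable (fun x y => Im (W (x, y))) (fun w => Im (Wx w))
    (Im (Ci * Wx z)%C) z r Hz) with (eps := eps / 2) as (d2 & Hd2 & H2); auto.
  { intros w Hw. exact (curve_deriv_Im _ _ _ (Hx w Hw)). }
  { exact (curve_deriv_Im _ _ _ Hy). }
  { now apply continuous_Im. }
  exists (Rmin d1 d2); split. now apply Rmin_glb_lt.
  intros w Hw.
  specialize (H1 w (Rlt_le_trans _ _ _ Hw (Rmin_l _ _))).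
  specialize (H2 w (Rlt_le_trans _ _ _ Hw (Rmin_r _ _))).
  rewrite !Re_Im_pair in H1, H2.
  eapply Rle_trans; [apply Cmod_le_Re_Im|].
  replace (Re (W w - W z - Wx z * (w - z))%C)
    with (Re (W w) - Re (W z) - (Re (Wx z) * Re (w - z)%C + Re (Ci * Wx z)%C * Im (w - z)%C))
    by (unfold Re, Im, Ci, Cminus, Cplus, Copp, Cmult; simpl; ring).
  replace (Im (W w - W z - Wx z * (w - z))%C)
    with (Im (W w) - Im (W z) - (Im (Wx z) * Re (w - z)%C + Im (Ci * Wx z)%C * Im (w - z)%C))
    by (unfold Re, Im, Ci, Cminus, Cplus, Copp, Cmult; simpl; ring).
  lra.
Qed.

(** Harmonicity is stated as [dzbar (dz f) = 0], which speaks directly of [f_z] only. Holomorphy of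
    the conjugate of [f_zbar] needs the operators in the other order. *)
Lemma mixed_partials (f : C -> C) (z : C) :
  class_C 2 unit_disk f -> Cmod z < 1 -> pdx (pdy f) z = pdy (pdx f) z.
Proof.
  intros (_ & He & (_ & Hex & _ & Hcyx & _) & (_ & Hey & Hcxy & _)) Hz.
  destruct Hcxy as [Hcxy _].
  assert (Hu : unit_disk z) by now apply unit_disk_Cmod.
  destruct z as [x y].
  assert (Hl : locally_2d (fun u v => unit_disk (u, v)) x y).
  { apply locally_2d_locally. apply locally_C_Cmod. exists (1 - Cmod (x, y)); split; [lra|].
    intros [a b] Hw. apply disk_nbhd in Hw. now apply unit_disk_Cmod. }
  specialize (Hcyx _ Hu). specialize (Hcxy _ Hu).
  unfold pdx, pdy, Re, Im; cbn [fst snd]. f_equal.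
  - apply (Schwarz (fun u v => fst (f (u, v))) x y).
    + destruct Hl as [d Hd]. exists d. intros u v A B. specialize (Hd u v A B).
      destruct (He _ Hd) as [[E1 _] [E2 _]]. destruct (Hey _ Hd) as [[E3 _] _].
      destruct (Hex _ Hd) as [_ [E4 _]]. repeat split; assumption.
    + apply continuity_2d_pt_filterlim.
      eapply filterlim_ext; [|apply (continuous_Re _ _ Hcxy)]. now intros [? ?].
    + apply continuity_2d_pt_filterlim.
      eapply filterlim_ext; [|apply (continuous_Re _ _ Hcyx)]. now intros [? ?].
  - apply (Schwarz (fun u v => snd (f (u, v))) x y).
    + destruct Hl as [d Hd]. exists d. intros u v A B. specialize (Hd u v A B).
      destruct (He _ Hd) as [[_ E1] [_ E2]]. destruct (Hey _ Hd) as [[_ E3] _].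
      destruct (Hex _ Hd) as [_ [_ E4]]. repeat split; assumption.
    + apply continuity_2d_pt_filterlim.
      eapply filterlim_ext; [|apply (continuous_Im _ _ Hcxy)]. now intros [? ?].
    + apply continuity_2d_pt_filterlim.
      eapply filterlim_ext; [|apply (continuous_Im _ _ Hcyx)]. now intros [? ?].
Qed.

Lemma Ci_sqr : (Ci * Ci)%C = (- (1))%C.
Proof. unfold Ci, Cmult, RtoC, Copp; simpl; f_equal; ring. Qed.

Lemma dz_partials (f : C -> C) (w : C) :
  ex_pdx (pdx f) w /\ ex_pdy (pdx f) w -> ex_pdx (pdy f) w /\ ex_pdy (pdy f) w ->
  curve_deriv (fun x => dz f (x, Im w)) (Re w)
    (/ 2 * (pdx (pdx f) w - Ci * pdx (pdy f) w))%C /\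
  curve_deriv (fun y => dz f (Re w, y)) (Im w)
    (/ 2 * (pdy (pdx f) w - Ci * pdy (pdy f) w))%C.
Proof.
  intros [Hxx Hyx] [Hxy Hyy]. split.
  - apply deriv_along_ext with (fun x => (/ 2 * (pdx f (x, Im w) - Ci * pdy f (x, Im w)))%C).
    { intros; unfold dz; field. }
    apply deriv_along_scal, deriv_along_minus; [|apply deriv_along_scal]; now apply pdx_correct.
  - apply deriv_along_ext with (fun y => (/ 2 * (pdx f (Re w, y) - Ci * pdy f (Re w, y)))%C).
    { intros; unfold dz; field. }
    apply deriv_along_scal, deriv_along_minus; [|apply deriv_along_scal]; now apply pdy_correct.
Qed.

Lemma holoC1_ext r phi psi dphi :
  (forall z, Cmod z < r -> phi z = psi z) -> holoC1 r phi dphi -> holoC1 r psi dphi.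
Proof.
  intros E H z Hz. destruct (H z Hz) as [D Cn]. split; auto.
  apply deriv_along_ext_loc with phi (r - Cmod z); auto; [lra|].
  intros w Hw. apply E. now apply disk_nbhd in Hw.
Qed.

Lemma harmonic_dz_holoC1 (f : C -> C) :
  harmonic_mapping f -> exists d, holoC1 1 (dz f) d.
Proof.
  intros [(_ & He & (_ & Hex & (Hxx & _) & (Hyx & _)) & (_ & Hey & (Hxy & _) & (Hyy & _))) Hh].
  exists (fun w => (/ 2 * (pdx (pdx f) w - Ci * pdx (pdy f) w))%C).
  assert (HXY := fun w (Hw : Cmod w < 1) => dz_partials f w
    (Hex w (proj2 (unit_disk_Cmod w) Hw)) (Hey w (proj2 (unit_disk_Cmod w) Hw))).
  intros z Hz.
  assert (Hc : continuous (fun w => (/ 2 * (pdx (pdx f) w - Ci * pdx (pdy f) w))%C) z).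
  { apply unit_disk_Cmod in Hz.
    apply continuous_Cmult; [apply continuous_Cconst|].
    apply continuous_Cminus; auto. apply continuous_Cmult; auto. apply continuous_Cconst. }
  split; auto.
  apply (cauchy_riemann_cderiv (dz f) (fun w => (/ 2 * (pdx (pdx f) w - Ci * pdx (pdy f) w))%C) z 1); auto.
  { intros w Hw. apply (HXY w Hw). }
  replace (Ci * (/ 2 * (pdx (pdx f) z - Ci * pdx (pdy f) z)))%C
    with (/ 2 * (pdy (pdx f) z - Ci * pdy (pdy f) z))%C; [apply (HXY z Hz)|].
  assert (Hz' := Hz). apply unit_disk_Cmod in Hz'. apply Hh in Hz'.
  unfold dzbar in Hz'. rewrite (pdx_unique _ _ _ (proj1 (HXY z Hz))), (pdy_unique _ _ _ (proj2 (HXY z Hz))) in Hz'.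
  set (p := (/ 2 * (pdx (pdx f) z - Ci * pdx (pdy f) z))%C) in *.
  set (q := (/ 2 * (pdy (pdx f) z - Ci * pdy (pdy f) z))%C) in *.
  (* The goal is [q = i p], the hypothesis [p + i q = 0]. As [field] treats [Ci] as an atom,
     [i^2 = -1] enters through the vanishing term [(1 + Ci * Ci) * q]. *)
  transitivity (Ci * p + - / 2 * Ci * (4 * ((p + Ci * q) / 2)) + (1 + Ci * Ci) * q)%C.
  - field.
  - rewrite Hz', Ci_sqr. ring.
Qed.

Lemma harmonic_conj_dzbar_holoC1 (f : C -> C) :
  harmonic_mapping f -> exists d, holoC1 1 (fun z => Cconj (dzbar f z)) d.
Proof.
  intros [HC Hh]. pose proof (fun z => mixed_partials f z HC) as Hmix.
  destruct HC as (_ & He & (_ & Hex & (Hxx & _) & (Hyx & _)) & (_ & Hey & (Hxy & _) & (Hyy & _))).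
  exists (fun w => Cconj (/ 2 * (pdx (pdx f) w + Ci * pdx (pdy f) w))%C).
  assert (HX : forall w, Cmod w < 1 -> curve_deriv (fun x => Cconj (dzbar f (x, Im w))) (Re w)
     (Cconj (/ 2 * (pdx (pdx f) w + Ci * pdx (pdy f) w)))%C).
  { intros w Hw. apply unit_disk_Cmod in Hw. apply curve_deriv_conj.
    apply deriv_along_ext with (fun x => (/ 2 * (pdx f (x, Im w) + Ci * pdy f (x, Im w)))%C).
    { intros; unfold dzbar; field. }
    apply deriv_along_scal, deriv_along_plus; [|apply deriv_along_scal];
      apply pdx_correct; [apply Hex|apply Hey]; auto. }
  assert (HY : forall w, Cmod w < 1 -> curve_deriv (fun y => Cconj (dzbar f (Re w, y))) (Im w)
     (Cconj (/ 2 * (pdy (pdx f) w + Ci * pdy (pdy f) w)))%C).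
  { intros w Hw. apply unit_disk_Cmod in Hw. apply curve_deriv_conj.
    apply deriv_along_ext with (fun y => (/ 2 * (pdx f (Re w, y) + Ci * pdy f (Re w, y)))%C).
    { intros; unfold dzbar; field. }
    apply deriv_along_scal, deriv_along_plus; [|apply deriv_along_scal];
      apply pdy_correct; [apply Hex|apply Hey]; auto. }
  intros z Hz.
  assert (Hc : continuous (fun w => Cconj (/ 2 * (pdx (pdx f) w + Ci * pdx (pdy f) w))%C) z).
  { apply unit_disk_Cmod in Hz. apply continuous_Cconj.
    apply continuous_Cmult; [apply continuous_Cconst|].
    apply continuous_Cplus; auto. apply continuous_Cmult; auto. apply continuous_Cconst. }
  split; auto.
  apply (cauchy_riemann_cderiv _ (fun w => Cconj (/ 2 * (pdx (pdx f) w + Ci * pdx (pdy f) w))%C) z 1); auto.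
  replace (Ci * Cconj (/ 2 * (pdx (pdx f) z + Ci * pdx (pdy f) z)))%C
    with (Cconj (/ 2 * (pdy (pdx f) z + Ci * pdy (pdy f) z)))%C; [now apply HY|].
  replace Ci with (Cconj (- Ci)%C) at 2
    by (unfold Cconj, Ci, Copp; simpl; f_equal; ring).
  rewrite <- Cmult_conj. f_equal.
  destruct (dz_partials f z (Hex z (proj2 (unit_disk_Cmod z) Hz))
    (Hey z (proj2 (unit_disk_Cmod z) Hz))) as [HX' HY'].
  assert (Hz' := Hz). apply unit_disk_Cmod in Hz'. apply Hh in Hz'.
  unfold dzbar in Hz'. rewrite (pdx_unique _ _ _ HX'), (pdy_unique _ _ _ HY') in Hz'.
  rewrite <- (Hmix z Hz) in *.
  set (xx := pdx (pdx f) z) in *. set (xy := pdx (pdy f) z) in *. set (yy := pdy (pdy f) z) in *.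
  (* Once the mixed partials agree they cancel, and the hypothesis becomes Laplace's equation, which
     no longer depends on the order of the Wirtinger operators. *)
  assert (E : (xx + yy)%C = RtoC 0).
  { rewrite <- Hz'. transitivity (xx - Ci * Ci * yy)%C.
    rewrite Ci_sqr; ring. field. }
  transitivity (/ 2 * (- Ci * xx - Ci * Ci * xy + Ci * (xx + yy) + (1 + Ci * Ci) * xy))%C.
  - field.
  - rewrite E, Ci_sqr. transitivity (/ 2 * (- Ci * xx - Ci * Ci * xy))%C.
    + rewrite Ci_sqr. ring.
    + field.
Qed.

Lemma wirtinger_decomposition (f h g : C -> C) (z : C) :
  analytic h -> analytic g ->
  (forall z, unit_disk z -> f z = (h z + Cconj (g z))%C) -> Cmod z < 1 ->
  dz f z = C_derive h z /\ dzbar f z = Cconj (C_derive g z).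
Proof.
  intros Hh Hg Hf Hz.
  (* One chain rule for both partial derivatives, with [d = 1] on the horizontal and [d = i] on the
     vertical line. The condition on [|c s - z|] keeps nearby points of the curve in the unit disk,
     where [f = h + conj g]. *)
  assert (Hcurve : forall (c : R -> C) t d, c t = z -> curve_deriv c t d ->
     (forall s, Cmod (c s - z) = Rabs (s - t)) ->
     curve_deriv (fun s => f (c s)) t (C_derive h z * d + Cconj (C_derive g z * d))%C).
  { intros c t d Hc Hd Hm.
    apply deriv_along_ext_loc with (fun s => (h (c s) + Cconj (g (c s)))%C) (1 - Cmod z); [lra| |].
    - intros s Hs. rewrite <- RtoC_minus, Cmod_R, <- Hm in Hs. apply disk_nbhd in Hs.
      symmetry. apply Hf. now apply unit_disk_Cmod.
    - apply deriv_along_plus.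
      + apply deriv_along_comp; auto. rewrite Hc. now apply analytic_cderiv.
      + apply (curve_deriv_conj (fun s => g (c s))).
        apply deriv_along_comp; auto. rewrite Hc. now apply analytic_cderiv. }
  assert (Ex : pdx f z = (C_derive h z + Cconj (C_derive g z))%C).
  { apply pdx_unique. rewrite <- (Cmult_1_r (C_derive h z)), <- (Cmult_1_r (C_derive g z)).
    apply (Hcurve (fun x => (x, Im z) : C)).
    - apply Re_Im_pair.
    - apply curve_deriv_hline.
    - intros s. destruct z as [x y]. simpl. rewrite <- Cmod_R. f_equal.
      unfold Cminus, Cplus, Copp, RtoC; simpl. f_equal; ring. }
  assert (Ey : pdy f z = (Ci * (C_derive h z - Cconj (C_derive g z)))%C).
  { apply pdy_unique.
    replace (Ci * (C_derive h z - Cconj (C_derive g z)))%C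
      with (C_derive h z * Ci + Cconj (C_derive g z * Ci))%C.
    2:{ rewrite Cmult_conj. replace (Cconj Ci) with (- Ci)%C. ring.
        unfold Cconj, Ci, Copp; simpl; f_equal; ring. }
    apply (Hcurve (fun y => (Re z, y) : C)).
    - apply Re_Im_pair.
    - apply curve_deriv_vline.
    - intros s. destruct z as [x y]. simpl. rewrite <- Cmod_R.
      transitivity (Cmod (Ci * RtoC (s - y))%C).
      + f_equal. unfold Ci, Cmult, Cminus, Cplus, Copp, RtoC; simpl. f_equal; ring.
      + rewrite Cmod_mult, Cmod_Ci. ring. }
  unfold dz, dzbar. rewrite Ex, Ey. set (p := C_derive h z). set (q := Cconj (C_derive g z)).
  split.
  - transitivity ((p + q - (Ci * Ci) * (p - q)) / 2)%C. field.
    rewrite Ci_sqr. field.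
  - transitivity ((p + q + (Ci * Ci) * (p - q)) / 2)%C. field.
    rewrite Ci_sqr. field.
Qed.

(** * The Schwarz-Pick lemma and distortion bounds *)

(** Allows the actual value at the centre to be replaced by a lower bound for it, and the actual
    modulus by a larger one. *)
Lemma pick_bound_monotone (a b s s' : R) :
  0 < a <= b -> b <= 1 -> 0 <= s <= s' -> s' < 1 ->
  (a - s') / (1 - a * s') <= (b - s) / (1 - b * s).
Proof.
  intros Ha Hb Hs Hs1.
  assert (0 < 1 - a * s') by nra. assert (0 < 1 - b * s) by nra.
  apply Rmult_le_reg_r with ((1 - a * s') * (1 - b * s)).
  { now apply Rmult_lt_0_compat. }
  replace ((a - s') / (1 - a * s') * ((1 - a * s') * (1 - b * s)))
    with ((a - s') * (1 - b * s)) by (field; lra).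
  replace ((b - s) / (1 - b * s) * ((1 - a * s') * (1 - b * s)))
    with ((b - s) * (1 - a * s')) by (field; lra).
  (* After clearing denominators the difference of the two sides is exactly the sum of this product
     and the next. *)
  assert (0 <= (b - a) * (1 - s * s')) by (apply Rmult_le_pos; nra).
  assert (0 <= (s' - s) * (1 - a * b)) by (apply Rmult_le_pos; nra).
  nra.
Qed.

(** Schwarz's lemma for [(psi - b) / (1 - b psi)] confines [psi z] to the pseudohyperbolic disk of
    radius [s = |z| / rho] about [b]; the leftmost point of that disk is [(b - s) / (1 - b s)]. *)
Lemma schwarz_pick_unit (rho : R) (psi dpsi : C -> C) (b : R) (z : C) :
  holoC1 rho psi dpsi -> (forall w, Cmod w < rho -> Cmod (psi w) < 1) ->
  psi (RtoC 0) = RtoC b -> 0 < b -> Cmod z < rho ->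
  (b - Cmod z / rho) / (1 - b * (Cmod z / rho)) <= Re (psi z).
Proof.
  intros Hpsi Hlt H0 Hb Hz. pose proof (Cmod_ge_0 z) as Hz0.
  assert (Hrho : 0 < rho) by lra.
  assert (Hb1 : b < 1).
  { specialize (Hlt (RtoC 0)). rewrite Cmod_0, H0, Cmod_R in Hlt.
    rewrite Rabs_pos_eq in Hlt by lra. apply Hlt; lra. }
  set (s := Cmod z / rho).
  assert (Hs : 0 <= s < 1).
  { unfold s. split. apply Rmult_le_pos; auto. apply Rlt_le, Rinv_0_lt_compat; auto.
    apply Rmult_lt_reg_r with rho; auto. unfold Rdiv. rewrite Rmult_assoc, Rinv_l; lra. }
  assert (Hden : forall w, Cmod w < rho -> (1 + (- RtoC b) * psi w)%C <> RtoC 0).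
  { intros w Hw E. specialize (Hlt w Hw).
    assert (E1 : (RtoC b * psi w)%C = RtoC 1).
    { replace (RtoC b * psi w)%C with (1 - (1 + (- RtoC b) * psi w))%C by ring. rewrite E; ring. }
    assert (E2 : b * Cmod (psi w) = 1).
    { rewrite <- (Rabs_pos_eq b), <- Cmod_R, <- Cmod_mult, E1 by lra. apply Cmod_1. }
    pose proof (Cmod_ge_0 (psi w)). nra. }
  pose proof (holoC1_affine _ _ _ (RtoC (- b)) (RtoC 1) Hpsi) as Hn.
  pose proof (holoC1_affine _ _ _ (RtoC 1) (- RtoC b)%C Hpsi) as Hd.
  pose proof (holoC1_div _ _ _ _ _ Hn Hd Hden) as Hom.
  assert (Hsq : forall w, Cmod (RtoC (- b) + 1 * psi w)%C ^ 2 =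
     (Re (psi w) - b) ^ 2 + Im (psi w) ^ 2).
  { intros w. rewrite Cmod2_alt. unfold Re, Im, Cplus, Cmult, RtoC; simpl. ring. }
  assert (Hsq2 : forall w, Cmod (1 + - RtoC b * psi w)%C ^ 2 =
     (1 - b * Re (psi w)) ^ 2 + (b * Im (psi w)) ^ 2).
  { intros w. rewrite Cmod2_alt. unfold Re, Im, Cplus, Cmult, Copp, RtoC; simpl. ring. }
  assert (Hs1 : rho * Cmod ((RtoC (- b) + 1 * psi z) / (1 + - RtoC b * psi z))%C <= 1 * Cmod z).
  { apply schwarz with (1 := Hom); auto.
    - rewrite H0, RtoC_opp. unfold Cdiv. ring.
    - intros w Hw. rewrite Cmod_div by auto.
      assert (Hp : 0 < Cmod (1 + - RtoC b * psi w)%C) by (apply Cmod_gt_0; auto).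
      apply Rmult_le_reg_r with (Cmod (1 + - RtoC b * psi w)%C); auto.
      unfold Rdiv. rewrite Rmult_assoc, Rinv_l, Rmult_1_r, Rmult_1_l by lra.
      apply Rsqr_incr_0_var; [|lra].
      unfold Rsqr. specialize (Hsq w). specialize (Hsq2 w). simpl in Hsq, Hsq2.
      specialize (Hlt w Hw). pose proof (Cmod2_alt (psi w)) as Hm. simpl in Hm.
      pose proof (Cmod_ge_0 (psi w)).
      assert (Re (psi w) * Re (psi w) + Im (psi w) * Im (psi w) < 1) by nra.
      (* This product is [|1 - b psi|^2 - |psi - b|^2], so the quotient has modulus at most 1. *)
      assert (0 <= (1 - b * b) * (1 - (Re (psi w) * Re (psi w) + Im (psi w) * Im (psi w))))
        by (apply Rmult_le_pos; nra).
      nra. }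
  rewrite Cmod_div in Hs1 by auto.
  assert (Hp : 0 < Cmod (1 + - RtoC b * psi z)%C) by (apply Cmod_gt_0; auto).
  assert (Hs2 : Cmod (RtoC (- b) + 1 * psi z)%C <= s * Cmod (1 + - RtoC b * psi z)%C).
  { apply Rmult_le_reg_l with (rho / Cmod (1 + - RtoC b * psi z)%C).
    apply Rdiv_lt_0_compat; auto.
    replace (rho / Cmod (1 + - RtoC b * psi z)%C * (s * Cmod (1 + - RtoC b * psi z)%C))
      with (1 * Cmod z) by (unfold s; field; lra).
    eapply Rle_trans; [|apply Hs1]. right. field. lra. }
  assert (Hs3 : Cmod (RtoC (- b) + 1 * psi z)%C ^ 2 <= s ^ 2 * Cmod (1 + - RtoC b * psi z)%C ^ 2).
  { rewrite <- Rpow_mult_distr. apply pow_incr. split; auto. apply Cmod_ge_0. }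
  rewrite Hsq, Hsq2 in Hs3.
  set (x := Re (psi z)) in *. set (y := Im (psi z)) in *.
  assert (Hbs : 0 <= b * s < 1) by (split; nra).
  assert (Hx : (x - b) ^ 2 <= (s * (1 - b * x)) ^ 2).
  { assert (0 <= y ^ 2 * (1 - (b * s) ^ 2)) by (apply Rmult_le_pos; nra). nra. }
  assert (Hx1 : x < 1).
  { specialize (Hlt z Hz). pose proof (re_le_Cmod (psi z)). pose proof (Rle_abs (Re (psi z))).
    unfold x. lra. }
  assert (Hbx : b - x <= s * (1 - b * x)).
  { apply Rnot_lt_le; intros Hc.
    assert (0 <= s * (1 - b * x)) by (apply Rmult_le_pos; nra). nra. }
  apply Rmult_le_reg_r with (1 - b * s); [lra|].
  unfold Rdiv. rewrite Rmult_assoc, Rinv_l by lra. lra.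
Qed.

(** The unit case for [u phi / N], where the rotation [u] makes the value at 0 positive. That value
    is [|phi(0)| / N]; monotonicity lowers it to [a]. *)
Lemma schwarz_pick_re (rho N a : R) (phi dphi : C -> C) (z : C) :
  holoC1 rho phi dphi -> 0 < N -> (forall w, Cmod w < rho -> Cmod (phi w) < N) ->
  0 < a -> a * N <= Cmod (phi (RtoC 0)) -> Cmod z < rho ->
  N * ((a - Cmod z / rho) / (1 - a * (Cmod z / rho)))
    <= Re (Cconj (phi (RtoC 0)) / RtoC (Cmod (phi (RtoC 0))) * phi z)%C.
Proof.
  intros Hphi HN Hlt Ha HaN Hz. pose proof (Cmod_ge_0 z) as Hz0.
  set (al := phi (RtoC 0)) in *.
  assert (Hal : 0 < Cmod al) by nra.
  assert (HalN : Cmod al < N). { apply Hlt. rewrite Cmod_0. lra. }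
  assert (Hn : RtoC (Cmod al) <> RtoC 0) by (intros E; injection E; lra).
  assert (HnN : RtoC N <> RtoC 0) by (intros E; injection E; lra).
  set (u := (Cconj al / RtoC (Cmod al))%C).
  assert (Hu : Cmod u = 1).
  { unfold u. rewrite Cmod_div, Cmod_conj, Cmod_R, Rabs_pos_eq by (auto; lra). field; lra. }
  assert (Hual : (u * al)%C = RtoC (Cmod al)).
  { unfold u. transitivity ((al * Cconj al) / RtoC (Cmod al))%C; [field; auto|].
    rewrite <- Cmod2_conj, RtoC_pow. field; auto. }
  pose proof (holoC1_affine _ _ _ (RtoC 0) (u / RtoC N)%C Hphi) as Hpsi.
  assert (H : (Cmod al / N - Cmod z / rho) / (1 - Cmod al / N * (Cmod z / rho))
     <= Re (0 + u / RtoC N * phi z)%C).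
  { apply schwarz_pick_unit with (1 := Hpsi); auto.
    - intros w Hw. rewrite Cplus_0_l, Cmod_mult, Cmod_div, Hu, Cmod_R, Rabs_pos_eq by (auto; lra).
      specialize (Hlt w Hw). apply Rmult_lt_reg_l with N; auto.
      replace (N * (1 / N * Cmod (phi w))) with (Cmod (phi w)) by (field; lra). lra.
    - fold al. rewrite RtoC_div by lra. rewrite <- Hual. field; auto.
    - apply Rdiv_lt_0_compat; auto. }
  assert (HE : Re (u * phi z)%C = N * Re (0 + u / RtoC N * phi z)%C).
  { rewrite <- re_scal_l. f_equal. field; auto. }
  rewrite HE. apply Rmult_le_compat_l; [lra|].
  eapply Rle_trans; [|apply H].
  assert (Hb : a <= Cmod al / N <= 1).
  { split; apply Rmult_le_reg_r with N; auto; unfold Rdiv; rewrite Rmult_assoc, Rinv_l; lra. }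
  assert (Hs : 0 <= Cmod z / rho < 1).
  { split. apply Rmult_le_pos; auto. apply Rlt_le, Rinv_0_lt_compat; lra.
    apply Rmult_lt_reg_r with rho; [lra|]. unfold Rdiv. rewrite Rmult_assoc, Rinv_l; lra. }
  apply pick_bound_monotone; lra.
Qed.

(** Stands in for integrating [dq <= dp] over [[0, 1]]: the mean value theorem for [p - q] asks for
    no integrability. *)
Lemma MVT_lower_bound (p q dp dq : R -> R) :
  (forall t, 0 <= t <= 1 -> is_derive p t (dp t)) ->
  (forall t, 0 <= t <= 1 -> is_derive q t (dq t)) ->
  (forall t, 0 <= t <= 1 -> dq t <= dp t) -> q 1 - q 0 <= p 1 - p 0.
Proof.
  intros Hp Hq Hle.
  assert (HD : forall t, 0 <= t <= 1 -> is_derive (fun t => p t - q t) t (dp t - dq t)).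
  { intros t Ht. apply (is_derive_minus (V := R_NormedModule)); auto. }
  destruct (MVT_gen (fun t => p t - q t) 0 1 (fun t => dp t - dq t)) as (c & Hc & E).
  - rewrite Rmin_left, Rmax_right by lra. intros; apply HD; lra.
  - rewrite Rmin_left, Rmax_right by lra. intros t Ht.
    apply continuity_pt_filterlim. apply (ex_derive_continuous (V := R_NormedModule) (fun t => p t - q t) t).
    eexists. now apply HD.
  - rewrite Rmin_left, Rmax_right in Hc by lra. specialize (Hle c Hc). lra.
Qed.

Lemma segment_in_disk (r : R) (z1 z2 : C) (t : R) :
  Cmod z1 < r -> Cmod z2 < r -> 0 <= t <= 1 -> Cmod (z2 + RtoC t * (z1 - z2))%C < r.
Proof.
  intros H1 H2 Ht.
  replace (z2 + RtoC t * (z1 - z2))%C with (RtoC (1 - t) * z2 + RtoC t * z1)%C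
    by (rewrite RtoC_minus; ring).
  eapply Rle_lt_trans; [apply Cmod_triangle|].
  rewrite !Cmod_mult, !Cmod_R, !Rabs_pos_eq by lra.
  pose proof (Rmax_l (Cmod z1) (Cmod z2)). pose proof (Rmax_r (Cmod z1) (Cmod z2)).
  assert (Rmax (Cmod z1) (Cmod z2) < r) by now apply Rmax_lub_lt.
  assert ((1 - t) * Cmod z2 <= (1 - t) * Rmax (Cmod z1) (Cmod z2))
    by (apply Rmult_le_compat_l; lra).
  assert (t * Cmod z1 <= t * Rmax (Cmod z1) (Cmod z2)) by (apply Rmult_le_compat_l; lra).
  lra.
Qed.

Lemma deriv_segment (F phi : C -> C) (r : R) (c z1 z2 : C) (t : R) :
  (forall z, Cmod z < r -> cderiv F z (phi z)) ->
  Cmod z1 < r -> Cmod z2 < r -> 0 <= t <= 1 ->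
  is_derive (fun t => Re (c * F (z2 + RtoC t * (z1 - z2)))%C) t
    (Re (c * (phi (z2 + RtoC t * (z1 - z2)) * (z1 - z2)))%C).
Proof.
  intros HF H1 H2 Ht.
  apply (curve_deriv_Re (fun t => (c * F (z2 + RtoC t * (z1 - z2)))%C)).
  apply deriv_along_scal.
  apply (deriv_along_comp RtoC F (fun t => (z2 + RtoC t * (z1 - z2))%C)).
  { now apply HF, segment_in_disk. }
  assert (Hd : curve_deriv (fun t => (z2 + RtoC t * (z1 - z2))%C) t
    (0 + (1 * (z1 - z2) + RtoC t * 0))%C).
  { apply deriv_along_plus. apply deriv_along_const.
    apply (deriv_along_mult RtoC RtoC (fun _ => (z1 - z2)%C)).
    apply deriv_along_id. apply deriv_along_const. }
  replace (0 + (1 * (z1 - z2) + RtoC t * 0))%C with (z1 - z2)%C in Hd by ring.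
  exact Hd.
Qed.

Lemma Re_rotation (d p u : C) :
  Re (u * Cconj d * (p * d))%C = Cmod d ^ 2 * Re (u * p)%C.
Proof.
  rewrite Cmod2_alt. unfold Re, Im, Cconj, Cmult; simpl. ring.
Qed.

(* Noshiro-Warschawski: on the segment, [Cconj (z1 - z2) * F] has a derivative whose
   rotation by [u] has real part at least [m * Cmod (z1 - z2) ^ 2]. *)
Lemma segment_lower_bound (F phi : C -> C) (r m : R) (u z1 z2 : C) :
  (forall z, Cmod z < r -> cderiv F z (phi z)) -> Cmod u = 1 ->
  (forall z, Cmod z < r -> m <= Re (u * phi z)%C) ->
  Cmod z1 < r -> Cmod z2 < r ->
  m * Cmod (z1 - z2) <= Cmod (F z1 - F z2).
Proof.
  intros HF Hu Hm H1 H2. set (d := (z1 - z2)%C).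
  destruct (Req_dec (Cmod d) 0) as [E|E].
  { rewrite E, Rmult_0_r. apply Cmod_ge_0. }
  assert (Hd : 0 < Cmod d) by (pose proof (Cmod_ge_0 d); lra).
  assert (H : Cmod d ^ 2 * m * 1 - Cmod d ^ 2 * m * 0 <=
    Re (u * Cconj d * F (z2 + RtoC 1 * (z1 - z2)))%C -
    Re (u * Cconj d * F (z2 + RtoC 0 * (z1 - z2)))%C).
  { apply (MVT_lower_bound (fun t => Re (u * Cconj d * F (z2 + RtoC t * (z1 - z2)))%C)
      (fun t => Cmod d ^ 2 * m * t)) with
      (dp := fun t => Re (u * Cconj d * (phi (z2 + RtoC t * (z1 - z2)) * (z1 - z2)))%C)
      (dq := fun _ => Cmod d ^ 2 * m).
    - intros t Ht. now apply (deriv_segment F phi r).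
    - intros t Ht. auto_derive; auto. ring.
    - intros t Ht. fold d. rewrite Re_rotation. apply Rmult_le_compat_l.
      apply pow_le, Cmod_ge_0. now apply Hm, segment_in_disk. }
  replace (z2 + RtoC 1 * (z1 - z2))%C with z1 in H by ring.
  replace (z2 + RtoC 0 * (z1 - z2))%C with z2 in H by ring.
  assert (Hle : Re (u * Cconj d * F z1)%C - Re (u * Cconj d * F z2)%C <= Cmod d * Cmod (F z1 - F z2)%C).
  { replace (Re (u * Cconj d * F z1)%C - Re (u * Cconj d * F z2)%C)
      with (Re (u * Cconj d * (F z1 - F z2))%C)
      by (unfold Re, Cmult, Cminus, Cplus, Copp; simpl; ring).
    eapply Rle_trans; [apply Rle_abs|]. eapply Rle_trans; [apply re_le_Cmod|].
    rewrite !Cmod_mult, Hu, Cmod_conj. lra. }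
  apply Rmult_le_reg_l with (Cmod d); auto. nra.
Qed.

(* [N * rho] times the integral of [(a - x) / (1 - a * x)] over [0, s]. *)
Definition growth (N rho a s : R) : R :=
  N * rho * (s / a + (1 - a ^ 2) / a ^ 2 * ln (1 - a * s)).

(** The argument of [segment_lower_bound] on the segment from 0 to [z], where the lower bound for
    [Re (u phi)] varies with the modulus; the comparison function is [growth] instead of a linear
    one. *)
Lemma radial_lower_bound (F phi : C -> C) (N rho a : R) (u z : C) :
  0 < a < 1 -> 0 < rho ->
  (forall z, Cmod z < rho -> cderiv F z (phi z)) -> Cmod u = 1 ->
  (forall z, Cmod z < rho ->
     N * ((a - Cmod z / rho) / (1 - a * (Cmod z / rho))) <= Re (u * phi z)%C) ->
  Cmod z < rho ->
  growth N rho a (Cmod z / rho) <= Cmod (F z - F (RtoC 0)).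
Proof.
  intros Ha Hrho HF Hu Hm Hz.
  destruct (Req_dec (Cmod z) 0) as [E|E].
  { rewrite E. unfold growth, Rdiv. rewrite !Rmult_0_l, Rmult_0_r, Rminus_0_r, ln_1, !Rmult_0_r, Rplus_0_r, Rmult_0_r.
    apply Cmod_ge_0. }
  assert (Hd : 0 < Cmod z) by (pose proof (Cmod_ge_0 z); lra).
  set (s := Cmod z / rho).
  assert (Hs : 0 < s < 1).
  { unfold s. split. apply Rdiv_lt_0_compat; auto.
    apply Rmult_lt_reg_r with rho; auto. unfold Rdiv. rewrite Rmult_assoc, Rinv_l; lra. }
  assert (H : Cmod z * growth N rho a (1 * s) - Cmod z * growth N rho a (0 * s) <=
    Re (u * Cconj (z - 0) * F (0 + RtoC 1 * (z - 0)))%C -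
    Re (u * Cconj (z - 0) * F (0 + RtoC 0 * (z - 0)))%C).
  { apply (MVT_lower_bound (fun t => Re (u * Cconj (z - 0) * F (0 + RtoC t * (z - 0)))%C)
      (fun t => Cmod z * growth N rho a (t * s))) with
      (dp := fun t => Re (u * Cconj (z - 0) * (phi (0 + RtoC t * (z - 0)) * (z - 0)))%C)
      (dq := fun t => Cmod z ^ 2 * (N * ((a - t * s) / (1 - a * (t * s))))).
    - intros t Ht. apply (deriv_segment F phi rho); auto. rewrite Cmod_0; auto.
    (* Differentiating in [t] brings out the factor [rho * s = |z|], which explains the square in
       [dq]. *)
    - intros t Ht. assert (0 < 1 - a * (t * s)).
      { assert (0 <= t * s < 1) by (split; nra). nra. }
      unfold growth. auto_derive; [lra|].
      replace (Cmod z) with (s * rho) by (unfold s; field; lra). field. lra.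
    - intros t Ht. rewrite Re_rotation.
      replace (z - 0)%C with z by ring. rewrite Cplus_0_l. apply Rmult_le_compat_l.
      apply pow_le; lra.
      assert (Ht2 : Cmod (RtoC t * z)%C = t * Cmod z).
      { rewrite Cmod_mult, Cmod_R, Rabs_pos_eq; lra. }
      replace (t * s) with (Cmod (RtoC t * z)%C / rho).
      + apply Hm. rewrite Ht2. nra.
      + rewrite Ht2. unfold s. field. lra. }
  replace (0 + RtoC 1 * (z - 0))%C with z in H by ring.
  replace (0 + RtoC 0 * (z - 0))%C with (RtoC 0) in H by ring.
  replace (z - 0)%C with z in H by ring.
  assert (Hle : Re (u * Cconj z * F z)%C - Re (u * Cconj z * F (RtoC 0))%C
                <= Cmod z * Cmod (F z - F (RtoC 0))%C).
  { replace (Re (u * Cconj z * F z)%C - Re (u * Cconj z * F (RtoC 0))%C)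
      with (Re (u * Cconj z * (F z - F (RtoC 0)))%C)
      by (unfold Re, Cmult, Cminus, Cplus, Copp; simpl; ring).
    eapply Rle_trans; [apply Rle_abs|]. eapply Rle_trans; [apply re_le_Cmod|].
    rewrite !Cmod_mult, Hu, Cmod_conj. lra. }
  assert (G0 : growth N rho a (0 * s) = 0).
  { unfold growth, Rdiv. rewrite !Rmult_0_l, Rmult_0_r, Rminus_0_r, ln_1. ring. }
  rewrite G0, Rmult_1_l in H.
  apply Rmult_le_reg_l with (Cmod z); auto. lra.
Qed.

(** * Openness *)

Lemma C_cauchy_complete (zn : nat -> C) :
  (forall eps, 0 < eps -> exists n0, forall n m, (n0 <= n)%nat -> (n0 <= m)%nat ->
     Cmod (zn n - zn m) < eps) ->
  exists z, forall eps, 0 < eps -> exists n0, forall n, (n0 <= n)%nat -> Cmod (zn n - z) < eps.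
Proof.
  intros H.
  destruct (Rcomplete.R_complete (fun n => Re (zn n))) as [x Hx].
  { intros eps He. destruct (H eps He) as [n0 Hn]. exists n0. intros n m Ha Hb.
    unfold Rdist. eapply Rle_lt_trans; [|apply (Hn n m Ha Hb)].
    apply (re_le_Cmod (zn n - zn m)%C). }
  destruct (Rcomplete.R_complete (fun n => Im (zn n))) as [y Hy].
  { intros eps He. destruct (H eps He) as [n0 Hn]. exists n0. intros n m Ha Hb.
    unfold Rdist. eapply Rle_lt_trans; [|apply (Hn n m Ha Hb)].
    apply (im_le_Cmod (zn n - zn m)%C). }
  exists (x, y). intros eps He.
  destruct (Hx (eps / 2)) as [n1 H1]; [lra|]. destruct (Hy (eps / 2)) as [n2 H2]; [lra|].
  exists (n1 + n2)%nat. intros n Hn.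
  specialize (H1 n ltac:(lia)). specialize (H2 n ltac:(lia)). unfold Rdist in H1, H2.
  eapply Rle_lt_trans; [apply Cmod_le_Re_Im|].
  change (Rabs (Re (zn n) - x) + Rabs (Im (zn n) - y) < eps). lra.
Qed.

(** Banach iteration from 0 with ratio one half. The steps are at most [c / 2^n], so the iterates
    and their limit stay within [2 c < e], inside the open disk where [T] contracts. *)
Lemma contraction_solvable (T : C -> C) (e c : R) :
  Cmod (T (RtoC 0)) <= c -> 2 * c < e ->
  (forall z1 z2, Cmod z1 < e -> Cmod z2 < e -> Cmod (T z1 - T z2) <= / 2 * Cmod (z1 - z2)) ->
  exists z, Cmod z < e /\ T z = z.
Proof.
  intros Hc Hce HT. pose proof (Cmod_ge_0 (T (RtoC 0))) as Hc0.
  set (zn := fun n => Nat.iter n T (RtoC 0)).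
  assert (HS : forall n, zn (S n) = T (zn n)) by reflexivity.
  assert (Hq : forall n, 0 < (/ 2) ^ n) by (intros; apply pow_lt; lra).
  assert (Hb : forall n, Cmod (zn n) <= 2 * c * (1 - (/ 2) ^ n) /\
                         Cmod (zn (S n) - zn n) <= c * (/ 2) ^ n).
  { induction n as [|n [I1 I2]].
    - simpl. rewrite Cmod_0. split; [lra|].
      replace (T 0 - 0)%C with (T (RtoC 0)) by ring. lra.
    - assert (J1 : Cmod (zn (S n)) <= 2 * c * (1 - (/ 2) ^ S n)).
      { replace (zn (S n)) with ((zn (S n) - zn n) + zn n)%C by ring.
        eapply Rle_trans; [apply Cmod_triangle|]. rewrite <- tech_pow_Rmult. lra. }
      split; auto. rewrite (HS (S n)), (HS n).
      eapply Rle_trans; [apply HT|].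
      + pose proof (Hq (S n)). rewrite <- HS. nra.
      + pose proof (Hq n). nra.
      + rewrite <- HS, <- tech_pow_Rmult. lra. }
  assert (Hlt : forall n, Cmod (zn n) < e).
  { intros n. destruct (Hb n) as [I _]. pose proof (Hq n). nra. }
  assert (Htel : forall n k, Cmod (zn (n + k)%nat - zn n) <= 2 * c * (/ 2) ^ n * (1 - (/ 2) ^ k)).
  { intros n. induction k as [|k IH].
    - rewrite Nat.add_0_r. simpl. replace (zn n - zn n)%C with (RtoC 0) by ring. rewrite Cmod_0. lra.
    - rewrite Nat.add_succ_r.
      replace (zn (S (n + k)) - zn n)%C with ((zn (S (n + k)) - zn (n + k)%nat) + (zn (n + k)%nat - zn n))%C by ring.
      eapply Rle_trans; [apply Cmod_triangle|].
      destruct (Hb (n + k)%nat) as [_ I]. rewrite pow_add in I. rewrite <- tech_pow_Rmult. lra. }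
  assert (Hpow : forall eps, 0 < eps -> exists n, (/ 2) ^ n < eps).
  { intros eps He. destruct (pow_lt_1_zero (/ 2)) with (y := eps) as [n Hn]; auto.
    rewrite Rabs_pos_eq; lra.
    exists n. specialize (Hn n (le_n n)). rewrite Rabs_pos_eq in Hn; auto.
    left; auto. }
  destruct (C_cauchy_complete zn) as [z Hz].
  { intros eps He. destruct (Hpow (eps / (4 * (c + 1)))) as [n0 Hn0].
    { apply Rdiv_lt_0_compat; lra. }
    assert (Hsmall : 2 * c * (/ 2) ^ n0 < eps / 2).
    { apply (Rmult_lt_compat_l (2 * (c + 1))) in Hn0; [|lra].
      replace (2 * (c + 1) * (eps / (4 * (c + 1)))) with (eps / 2) in Hn0 by (field; lra).
      pose proof (Hq n0). nra. }
    assert (Hone : forall n, (n0 <= n)%nat -> Cmod (zn n - zn n0) < eps / 2).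
    { intros n Hn. replace n with (n0 + (n - n0))%nat by lia.
      eapply Rle_lt_trans; [apply Htel|]. pose proof (Hq (n - n0)%nat). pose proof (Hq n0).
      eapply Rle_lt_trans; [|apply Hsmall].
      rewrite <- (Rmult_1_r (2 * c * (/ 2) ^ n0)) at 2. apply Rmult_le_compat_l; [|lra].
      apply Rmult_le_pos; lra. }
    exists n0. intros n m Hn Hm. pose proof (Hone n Hn). pose proof (Hone m Hm).
    replace (zn n - zn m)%C with ((zn n - zn n0) + - (zn m - zn n0))%C by ring.
    eapply Rle_lt_trans; [apply Cmod_triangle|]. rewrite Cmod_opp. lra. }
  assert (Hze : Cmod z < e).
  { destruct (Hz ((e - 2 * c) / 2)) as [n Hn]; [lra|]. specialize (Hn n (le_n n)).
    replace z with (- (zn n - z) + zn n)%C by ring.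
    eapply Rle_lt_trans; [apply Cmod_triangle|]. rewrite Cmod_opp.
    destruct (Hb n) as [I _]. pose proof (Hq n). nra. }
  exists z; split; auto.
  apply Ceq_minus, Cmod_eq_0. apply Rle_antisym; [|apply Cmod_ge_0].
  apply Rnot_lt_le. intros Hpos.
  (* For this [n], the distance [|T z - z|] is at most [|z - z_n| / 2 + |z_(n+1) - z|], hence below
     three quarters of itself. *)
  destruct (Hz (Cmod (T z - z)%C / 2)) as [n Hn]; [lra|].
  pose proof (Hn n (le_n n)) as Hn1. pose proof (Hn (S n) (le_S _ _ (le_n n))) as Hn2.
  pose proof (HT z (zn n) Hze (Hlt n)) as Hn3. rewrite <- HS in Hn3.
  replace (z - zn n)%C with (- (zn n - z))%C in Hn3 by ring. rewrite Cmod_opp in Hn3.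
  assert (Cmod (T z - z)%C <= Cmod (T z - zn (S n))%C + Cmod (zn (S n) - z)%C).
  { replace (T z - z)%C with ((T z - zn (S n)) + (zn (S n) - z))%C by ring. apply Cmod_triangle. }
  lra.
Qed.

Lemma segment_upper_bound (F phi : C -> C) (r m : R) (z1 z2 : C) :
  (forall z, Cmod z < r -> cderiv F z (phi z)) ->
  (forall z, Cmod z < r -> Cmod (phi z) <= m) ->
  Cmod z1 < r -> Cmod z2 < r ->
  Cmod (F z1 - F z2) <= m * Cmod (z1 - z2).
Proof.
  intros HF Hm H1 H2.
  destruct (unimodular_rotation (F z1 - F z2)%C) as (u & Hu & Hr).
  assert (H : Re (u * F (z2 + RtoC 1 * (z1 - z2)))%C - Re (u * F (z2 + RtoC 0 * (z1 - z2)))%C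
    <= m * Cmod (z1 - z2) * 1 - m * Cmod (z1 - z2) * 0).
  { apply (MVT_lower_bound (fun t => m * Cmod (z1 - z2) * t)
      (fun t => Re (u * F (z2 + RtoC t * (z1 - z2)))%C)) with
      (dp := fun _ => m * Cmod (z1 - z2))
      (dq := fun t => Re (u * (phi (z2 + RtoC t * (z1 - z2)) * (z1 - z2)))%C).
    - intros t Ht. auto_derive; auto. ring.
    - intros t Ht. now apply (deriv_segment F phi r).
    - intros t Ht. eapply Rle_trans; [apply Rle_abs|]. eapply Rle_trans; [apply re_le_Cmod|].
      rewrite !Cmod_mult, Hu, Rmult_1_l. apply Rmult_le_compat_r; [apply Cmod_ge_0|].
      now apply Hm, segment_in_disk. }
  replace (z2 + RtoC 1 * (z1 - z2))%C with z1 in H by ring.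
  replace (z2 + RtoC 0 * (z1 - z2))%C with z2 in H by ring.
  replace (Cmod (F z1 - F z2)) with (Re (u * F z1)%C - Re (u * F z2)%C).
  - lra.
  - rewrite <- (re_RtoC (Cmod (F z1 - F z2)%C)), <- Hr.
    unfold Re, Cmult, Cminus, Cplus, Copp; simpl; ring.
Qed.

Lemma harmonic_open_at_0 (h g dh dg : C -> C) (r : R) :
  0 < r ->
  (forall z, Cmod z < r -> cderiv h z (dh z)) -> (forall z, Cmod z < r -> cderiv g z (dg z)) ->
  continuous dh (RtoC 0) -> continuous dg (RtoC 0) ->
  Cmod (dg (RtoC 0)) < Cmod (dh (RtoC 0)) ->
  exists del, 0 < del /\ forall w, Cmod (w - (h (RtoC 0) + Cconj (g (RtoC 0)))) < del ->
    exists z, Cmod z < r /\ (h z + Cconj (g z))%C = w.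
Proof.
  intros Hr Hh Hg Ch Cg Hpq.
  set (p := dh (RtoC 0)) in *. set (q := dg (RtoC 0)) in *.
  set (L := Cmod p - Cmod q). assert (HL : 0 < L) by (unfold L; lra).
  pose proof (Cmod_ge_0 q) as Hq0.
  set (J := Cmod p ^ 2 - Cmod q ^ 2).
  assert (HJL : J = L * (Cmod p + Cmod q)) by (unfold J, L; ring).
  assert (HJ : 0 < J) by (rewrite HJL; apply Rmult_lt_0_compat; lra).
  assert (HJ0 : RtoC J <> RtoC 0) by (intros E; injection E; lra).
  assert (HJC : RtoC J = (p * Cconj p - q * Cconj q)%C).
  { unfold J. now rewrite RtoC_minus, !Cmod2_conj. }
  (* The inverse of the real-linear map [k |-> p * k + Cconj (q * k)]. *)
  set (Ainv := fun w => ((Cconj p * w - Cconj q * Cconj w) / RtoC J)%C).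
  assert (HAinv : forall w, (p * Ainv w + Cconj (q * Ainv w))%C = w).
  { intros w. unfold Ainv. rewrite Cmult_conj, Cdiv_conj by auto.
    rewrite Cminus_conj, !Cmult_conj, !Cconj_conj.
    replace (Cconj (RtoC J)) with (RtoC J) by (unfold Cconj, RtoC; simpl; f_equal; ring).
    transitivity ((p * Cconj p - q * Cconj q) / RtoC J * w)%C; [field; auto|].
    rewrite <- HJC. field; auto. }
  assert (HAk : forall k, Ainv (p * k + Cconj (q * k))%C = k).
  { intros k. unfold Ainv. rewrite Cplus_conj, Cconj_conj, !Cmult_conj.
    transitivity ((p * Cconj p - q * Cconj q) / RtoC J * k)%C; [field; auto|].
    rewrite <- HJC. field; auto. }
  assert (HAsub : forall v w, (Ainv v - Ainv w)%C = Ainv (v - w)%C).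
  { intros v w. unfold Ainv. rewrite Cminus_conj. field; auto. }
  assert (HAopp : forall w, Ainv (- w)%C = (- Ainv w)%C).
  { intros w. unfold Ainv. rewrite Copp_conj. field; auto. }
  assert (HAle : forall w, Cmod (Ainv w) <= Cmod w / L).
  (* The determinant factors as [J = (|p| - |q|) (|p| + |q|)]; its second factor cancels the bound
     on the numerator. *)
  { intros w. unfold Ainv. rewrite Cmod_div, Cmod_R, (Rabs_pos_eq J) by (auto; lra).
    apply Rmult_le_reg_r with J; auto. unfold Rdiv. rewrite Rmult_assoc, Rinv_l, Rmult_1_r by lra.
    replace (Cmod w * / L * J) with ((Cmod p + Cmod q) * Cmod w) by (rewrite HJL; field; lra).
    eapply Rle_trans; [apply Cmod_triangle|]. rewrite Cmod_opp, !Cmod_mult, !Cmod_conj. lra. }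
  (* The nonlinear parts of [h] and [g] become [L / 4]-Lipschitz each; since [Ainv] has norm at most
     [1 / L], the iteration contracts by one half. *)
  destruct (proj1 (continuous_C_Cmod _ _) Ch (L / 4)) as (d1 & Hd1 & K1); [lra|].
  destruct (proj1 (continuous_C_Cmod _ _) Cg (L / 4)) as (d2 & Hd2 & K2); [lra|].
  set (e := Rmin r (Rmin d1 d2)).
  assert (He : 0 < e) by (repeat apply Rmin_glb_lt; auto).
  assert (Her : e <= r) by apply Rmin_l.
  assert (Hed1 : e <= d1) by (eapply Rle_trans; [apply Rmin_r|apply Rmin_l]).
  assert (Hed2 : e <= d2) by (eapply Rle_trans; [apply Rmin_r|apply Rmin_r]).
  assert (Lip : forall (k dk : C -> C) (c : C),
    (forall z, Cmod z < r -> cderiv k z (dk z)) ->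
    (forall z, Cmod z < e -> Cmod (dk z - c) <= L / 4) ->
    forall z1 z2, Cmod z1 < e -> Cmod z2 < e ->
      Cmod ((k z1 - c * z1) - (k z2 - c * z2)) <= L / 4 * Cmod (z1 - z2)).
  { intros k dk c Hk Hdk z1 z2 Hz1 Hz2.
    apply (segment_upper_bound (fun z => (k z - c * z)%C) (fun z => (dk z - c)%C) e); auto.
    intros z Hz. apply deriv_along_minus. apply Hk; lra. apply cderiv_Cmult_l. }
  assert (Lh := Lip h dh p Hh).
  assert (Lg := Lip g dg q Hg).
  assert (Hm0 : forall z, (z - 0)%C = z) by (intros; ring).
  specialize (Lh ltac:(intros z Hz; left; apply K1; rewrite Hm0; lra)).
  specialize (Lg ltac:(intros z Hz; left; apply K2; rewrite Hm0; lra)).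
  (* The first iterate then has modulus at most [e / 4], and [2 * (e / 4) < e]. *)
  exists (L * e / 4). split; [apply Rmult_lt_0_compat; nra|].
  intros w Hw.
  set (T := fun z => (z - Ainv (h z + Cconj (g z) - w))%C).
  destruct (contraction_solvable T e (e / 4)) as (z & Hz & Hfix).
  - unfold T. replace (0 - Ainv (h 0 + Cconj (g 0) - w))%C
      with (- Ainv (h 0 + Cconj (g 0) - w))%C by ring.
    rewrite Cmod_opp. eapply Rle_trans; [apply HAle|].
    replace (h 0 + Cconj (g 0) - w)%C with (- (w - (h 0 + Cconj (g 0))))%C by ring.
    rewrite Cmod_opp. apply Rmult_le_reg_r with L; auto.
    unfold Rdiv at 1. rewrite Rmult_assoc, Rinv_l by lra. lra.
  - lra.
  - intros z1 z2 Hz1 Hz2.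
    assert (E : (T z1 - T z2)%C = (- Ainv (((h z1 - p * z1) - (h z2 - p * z2)) +
        Cconj ((g z1 - q * z1) - (g z2 - q * z2))))%C).
    { unfold T.
      transitivity ((z1 - z2) - (Ainv (h z1 + Cconj (g z1) - w) - Ainv (h z2 + Cconj (g z2) - w)))%C; [ring|].
      rewrite <- (HAk (z1 - z2)%C), !HAsub.
      rewrite <- HAopp. f_equal. rewrite !Cminus_conj, !Cmult_conj, !Cminus_conj. ring. }
    rewrite E, Cmod_opp. eapply Rle_trans; [apply HAle|].
    apply Rmult_le_reg_r with L; auto. unfold Rdiv at 1. rewrite Rmult_assoc, Rinv_l by lra.
    rewrite Rmult_1_r. eapply Rle_trans; [apply Cmod_triangle|]. rewrite Cmod_conj.
    specialize (Lh z1 z2 Hz1 Hz2). specialize (Lg z1 z2 Hz1 Hz2). lra.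
  - exists z. split; [lra|].
    assert (E0 : Ainv (h z + Cconj (g z) - w)%C = RtoC 0).
    { transitivity (z - T z)%C; [unfold T; ring|]. rewrite Hfix. ring. }
    apply Ceq_minus. rewrite <- (HAinv (h z + Cconj (g z) - w)%C), E0.
    unfold Cconj, Cmult, Cplus, RtoC; simpl. f_equal; ring.
Qed.

Lemma harmonic_open_at (h g dh dg : C -> C) (r : R) (z0 : C) :
  (forall z, Cmod z < r -> cderiv h z (dh z)) -> (forall z, Cmod z < r -> cderiv g z (dg z)) ->
  Cmod z0 < r -> continuous dh z0 -> continuous dg z0 -> Cmod (dg z0) < Cmod (dh z0) ->
  forall e, 0 < e -> exists del, 0 < del /\
    forall w, Cmod (w - (h z0 + Cconj (g z0))) < del ->
    exists z, Cmod (z - z0) < e /\ (h z + Cconj (g z))%C = w.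
Proof.
  intros Hh Hg Hz0 Ch Cg Hpq e He.
  set (e' := Rmin e (r - Cmod z0)).
  assert (Htr : forall z, cderiv (fun z => z0 + z)%C z (RtoC 1)).
  { intros z. replace (RtoC 1) with (0 + 1)%C by ring.
    apply deriv_along_plus. apply deriv_along_const. apply deriv_along_id. }
  assert (Hin : forall z, Cmod z < e' -> Cmod (z0 + z)%C < r).
  { intros z Hz. apply disk_nbhd with z0. replace (z0 + z - z0)%C with z by ring.
    eapply Rlt_le_trans; [apply Hz|apply Rmin_r]. }
  assert (Hd : forall k dk : C -> C, (forall z, Cmod z < r -> cderiv k z (dk z)) ->
     forall z, Cmod z < e' -> cderiv (fun z => k (z0 + z)%C) z (dk (z0 + z)%C)).
  { intros k dk Hk z Hz. rewrite <- (Cmult_1_r (dk (z0 + z)%C)).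
    apply (deriv_along_comp (fun z => z) k (fun z => z0 + z)%C); auto. }
  assert (Hc : forall dk : C -> C, continuous dk z0 -> continuous (fun z => dk (z0 + z)%C) (RtoC 0)).
  { intros dk Hdk. apply (continuous_comp (fun z => z0 + z)%C dk).
    - eapply cderiv_continuous, Htr.
    - now rewrite Cplus_0_r. }
  destruct (harmonic_open_at_0 (fun z => h (z0 + z)%C) (fun z => g (z0 + z)%C)
    (fun z => dh (z0 + z)%C) (fun z => dg (z0 + z)%C) e') as (del & Hdel & H); auto.
  - apply Rmin_glb_lt; lra.
  - now rewrite Cplus_0_r.
  - exists del; split; auto. intros w Hw. rewrite Cplus_0_r in H.
    destruct (H w Hw) as (z & Hz & E). exists (z0 + z)%C. split; auto.
    replace (z0 + z - z0)%C with z by ring. eapply Rlt_le_trans; [apply Hz|apply Rmin_l].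
Qed.

(** * Covering *)

Lemma disk_0 (r : R) (z : C) : disk (RtoC 0) r z <-> Cmod z < r.
Proof. unfold disk. replace (z - 0)%C with z by ring. tauto. Qed.

Lemma open_Cmod (U : C -> Prop) :
  open U <-> forall z, U z -> exists d, 0 < d /\ forall w, Cmod (w - z) < d -> U w.
Proof.
  split.
  - intros H z Hz. apply locally_C_Cmod. now apply H.
  - intros H z Hz. apply locally_C_Cmod. now apply H.
Qed.

(** On the segment from [p] to [q], let [T] be the supremum of the initial stretches inside [U]. If
    [c T] is in [U], either [T = 1] and [q] is a common point, or [T] could be increased. If it is
    in [V], a common point is [p] or lies just before [T]. *)
Lemma disk_connected (r : R) : connected_set (disk (RtoC 0) r).
Proof.
  intros U V HU HV Hcov (p & Hp & Up) (q & Hq & Vq).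
  rewrite open_Cmod in HU, HV. rewrite disk_0 in Hp, Hq.
  apply NNPP. intros Hno.
  set (c := fun t => (p + RtoC t * (q - p))%C).
  assert (Hc : forall t, 0 <= t <= 1 -> disk (RtoC 0) r (c t)).
  { intros t Ht. now apply disk_0, segment_in_disk. }
  assert (Hlip : forall W : C -> Prop, (forall z, W z -> exists d, 0 < d /\ forall w, Cmod (w - z) < d -> W w) ->
     forall t, W (c t) -> exists d, 0 < d /\ forall s, Rabs (s - t) < d -> W (c s)).
  { intros W HW t Wt. destruct (HW _ Wt) as (d & Hd & H). pose proof (Cmod_ge_0 (q - p)%C).
    exists (d / (Cmod (q - p) + 1)). split. apply Rdiv_lt_0_compat; lra.
    intros s Hs. apply H. unfold c.
    replace (p + RtoC s * (q - p) - (p + RtoC t * (q - p)))%C with (RtoC (s - t) * (q - p))%C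
      by (rewrite RtoC_minus; ring).
    rewrite Cmod_mult, Cmod_R. pose proof (Rabs_pos (s - t)).
    apply (Rmult_lt_compat_r (Cmod (q - p) + 1)) in Hs; [|lra].
    replace (d / (Cmod (q - p) + 1) * (Cmod (q - p) + 1)) with d in Hs by (field; lra). nra. }
  assert (Hc0 : c 0 = p) by (unfold c; ring).
  assert (Hc1 : c 1 = q) by (unfold c; ring).
  set (E := fun t => 0 <= t <= 1 /\ forall s, 0 <= s <= t -> U (c s)).
  destruct (completeness E) as [T [HTub HTlub]].
  - exists 1. intros t [Ht _]. lra.
  - exists 0. split; [lra|]. intros s Hs. replace s with 0 by lra. now rewrite Hc0.
  - assert (HT0 : 0 <= T).
    { apply HTub. split; [lra|]. intros s Hs. replace s with 0 by lra. now rewrite Hc0. }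
    assert (HT1 : T <= 1). { apply HTlub. intros t [Ht _]. lra. }
    assert (Hbelow : forall s, 0 <= s < T -> U (c s)).
    { intros s Hs. apply NNPP. intros Hn.
      assert (T <= s); [|lra]. apply HTlub. intros t [Ht H].
      apply Rnot_lt_le. intros Hlt. apply Hn, H. lra. }
    destruct (Hcov (c T)) as [HUT|HVT]; [apply Hc; lra| |].
    + destruct (Hlip U HU T HUT) as (d & Hd & H).
      destruct (Req_dec T 1) as [E1|E1].
      * apply Hno. exists q. rewrite disk_0. rewrite E1, Hc1 in HUT. auto.
      * assert (Hin : E (Rmin 1 (T + d / 2))).
        { split.
          - split. apply Rmin_glb; lra. apply Rmin_l.
          - intros s Hs. pose proof (Rmin_r 1 (T + d / 2)).
            destruct (Rlt_dec s T). apply Hbelow; lra. apply H. apply Rabs_def1; lra. }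
        apply HTub in Hin. assert (T < Rmin 1 (T + d / 2)) by (apply Rmin_glb_lt; lra). lra.
    + destruct (Hlip V HV T HVT) as (d & Hd & H).
      destruct (Req_dec T 0) as [E0|E0].
      * apply Hno. exists p. rewrite disk_0. rewrite E0, Hc0 in HVT. auto.
      * set (s := Rmax 0 (T - d / 2)).
        assert (Hs : 0 <= s < T). { split. apply Rmax_l. apply Rmax_lub_lt; lra. }
        assert (Hs2 : T - d / 2 <= s) by apply Rmax_r.
        apply Hno. exists (c s). split; [apply Hc; lra|]. split; [now apply Hbelow|].
        apply H. apply Rabs_def1; lra.
Qed.

(** The last hypothesis is properness over the target disk; with the expansion bounds it makes the
    image relatively closed there. *)
Lemma schlicht_disk_of_proper (f : C -> C) (r rho : R) :
  0 < r <= 1 -> 0 < rho -> f (RtoC 0) = RtoC 0 ->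
  (forall s, s < r -> exists c, 0 < c /\ forall z1 z2, Cmod z1 < s -> Cmod z2 < s ->
     c * Cmod (z1 - z2) <= Cmod (f z1 - f z2)) ->
  univalent_in f (disk (RtoC 0) r) ->
  (forall z, Cmod z < r -> continuous f z) ->
  (forall z, Cmod z < r -> forall e, 0 < e -> exists d, 0 < d /\
     forall w, Cmod (w - f z) < d -> exists z', Cmod (z' - z) < e /\ f z' = w) ->
  (forall b, b < rho -> exists s, s < r /\ forall z, Cmod z < r -> Cmod (f z) < b -> Cmod z < s) ->
  contains_schlicht_disk f (disk (RtoC 0) r) (RtoC 0) rho.
Proof.
  intros Hr Hrho H0 Hexp Hinj Hcont Hopen Hprop.
  assert (HUopen : forall W : C -> Prop, open W -> (forall z, W z -> Cmod z < r) ->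
     open (fun w => exists z, W z /\ f z = w)).
  { intros W HW HWr. rewrite open_Cmod in HW |- *. intros w (z & Wz & <-).
    destruct (HW z Wz) as (e & He & HWe).
    destruct (Hopen z (HWr z Wz) e He) as (d & Hd & H).
    exists d; split; auto. intros w Hw. destruct (H w Hw) as (z' & Hz' & E). eauto. }
  assert (Hdopen : open (disk (RtoC 0) r)).
  { apply open_Cmod. intros z Hz. rewrite disk_0 in Hz. exists (r - Cmod z). split; [lra|].
    intros w Hw. apply disk_0. now apply disk_nbhd in Hw. }
  assert (Hsurj : forall w, Cmod w < rho -> exists z, Cmod z < r /\ f z = w).
  { intros w Hw. apply NNPP. intros Hn.
    set (U := fun w => exists z, disk (RtoC 0) r z /\ f z = w).
    (* [V] is the interior of the complement of the image. A point of the target disk outside [V] is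
       a limit of values of [f], and must be shown to be a value itself. *)
    set (V := fun w => exists e, 0 < e /\ forall w', Cmod (w' - w) < e -> ~ U w').
    assert (HUV : forall w, Cmod w < rho -> U w \/ V w).
    { intros v Hv. apply NNPP. intros Hno. apply not_or_and in Hno. destruct Hno as [HnU HnV].
      assert (Hseq : forall n : nat, exists z, Cmod z < r /\ Cmod (f z - v) < / INR (S n)).
      { intros n. apply NNPP. intros Hz. apply HnV. exists (/ INR (S n)). split.
        - apply Rinv_0_lt_compat. apply lt_0_INR. lia.
        - intros w' Hw' (z & Hzr & E). apply Hz. exists z. rewrite E, <- disk_0. auto. }
      apply functional_choice in Hseq. destruct Hseq as [zn Hzn].
      (* A level strictly between [|v|] and [rho]: values close to [v] fall below it, so their
         preimages stay in a fixed smaller disk. *)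
      destruct (Hprop ((Cmod v + rho) / 2)) as (s & Hs & Hps); [lra|].
      assert (Hsmall : forall eps, 0 < eps -> exists n0, forall n, (n0 <= n)%nat -> Cmod (f (zn n) - v) < eps).
      { intros eps He. destruct (archimed_cor1 eps He) as (n0 & Hn0 & Hn0'). exists n0.
        intros n Hn1. eapply Rlt_trans; [apply Hzn|]. eapply Rle_lt_trans; [|apply Hn0].
        apply Rinv_le_contravar. apply lt_0_INR; lia. apply le_INR; lia. }
      destruct (Hsmall ((rho - Cmod v) / 2)) as [n1 Hn1]; [lra|].
      assert (Hzs : forall n, (n1 <= n)%nat -> Cmod (zn n) < s).
      { intros n Hn2. apply Hps. apply Hzn.
        replace (f (zn n)) with ((f (zn n) - v) + v)%C by ring.
        eapply Rle_lt_trans; [apply Cmod_triangle|]. specialize (Hn1 n Hn2). lra. }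
      destruct (Hexp s Hs) as (c & Hc & Hcexp).
      destruct (C_cauchy_complete zn) as [z Hz].
      { intros eps He. destruct (Hsmall (c * eps / 2)) as [n2 Hn2].
        { assert (0 < c * eps) by now apply Rmult_lt_0_compat. lra. }
        exists (n1 + n2)%nat. intros n m Hn3 Hm3.
        apply Rmult_lt_reg_l with c; auto.
        eapply Rle_lt_trans; [apply Hcexp; apply Hzs; lia|].
        replace (f (zn n) - f (zn m))%C with ((f (zn n) - v) + - (f (zn m) - v))%C by ring.
        eapply Rle_lt_trans; [apply Cmod_triangle|]. rewrite Cmod_opp.
        pose proof (Hn2 n ltac:(lia)). pose proof (Hn2 m ltac:(lia)). lra. }
      assert (Hzr : Cmod z < r).
      { destruct (Hz (r - s)) as [n2 Hn2]; [lra|].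
        specialize (Hn2 (n1 + n2)%nat ltac:(lia)). specialize (Hzs (n1 + n2)%nat ltac:(lia)).
        replace z with (- (zn (n1 + n2)%nat - z) + zn (n1 + n2)%nat)%C by ring.
        eapply Rle_lt_trans; [apply Cmod_triangle|]. rewrite Cmod_opp. lra. }
      apply HnU. exists z. split; [now apply disk_0|].
      apply Ceq_minus, Cmod_eq_0, Rle_antisym; [|apply Cmod_ge_0].
      apply Rnot_lt_le. intros Hpos.
      destruct (proj1 (continuous_C_Cmod _ _) (Hcont z Hzr) (Cmod (f z - v)%C / 2)) as (d & Hd & Hcd); [lra|].
      destruct (Hz d Hd) as [n2 Hn2].
      destruct (Hsmall (Cmod (f z - v)%C / 2)) as [n3 Hn3]; [lra|].
      specialize (Hcd _ (Hn2 (n2 + n3)%nat ltac:(lia))). specialize (Hn3 (n2 + n3)%nat ltac:(lia)).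
      assert (Cmod (f z - v)%C <= Cmod (f (zn (n2 + n3)%nat) - f z)%C + Cmod (f (zn (n2 + n3)%nat) - v)%C); [|lra].
      rewrite <- (Cmod_opp (f (zn (n2 + n3)%nat) - f z)%C).
      replace (f z - v)%C with (- (f (zn (n2 + n3)%nat) - f z) + (f (zn (n2 + n3)%nat) - v))%C by ring.
      apply Cmod_triangle. }
    destruct (disk_connected rho U V) as (x & _ & Ux & (e & He & Vx)).
    - apply HUopen; auto. intros z. apply disk_0.
    - apply open_Cmod. intros v (e & He & Hv). exists (e / 2). split; [lra|].
      intros v' Hv'. exists (e / 2). split; [lra|]. intros w' Hw'. apply Hv.
      replace (w' - v)%C with ((w' - v') + (v' - v))%C by ring.
      eapply Rle_lt_trans; [apply Cmod_triangle|]. lra.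
    - intros v Hv. apply HUV. now apply disk_0.
    - exists (RtoC 0). split. apply disk_0. now rewrite Cmod_0.
      exists (RtoC 0). split; auto. apply disk_0. rewrite Cmod_0; lra.
    - exists w. split. now apply disk_0.
      destruct (HUV w Hw) as [(z & Hz & E)|]; auto. exfalso. apply Hn. exists z.
      now rewrite <- disk_0.
    - apply (Vx x); auto. replace (x - x)%C with (RtoC 0) by ring. now rewrite Cmod_0. }
  set (Om := fun z => Cmod z < r /\ Cmod (f z) < rho).
  assert (HOmopen : open Om).
  { apply open_Cmod. intros z [Hz Hfz].
    destruct (proj1 (continuous_C_Cmod _ _) (Hcont z Hz) (rho - Cmod (f z))) as (d & Hd & Hcd); [lra|].
    exists (Rmin d (r - Cmod z)). split. apply Rmin_glb_lt; lra.
    intros w Hw. split.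
    - apply disk_nbhd with z. eapply Rlt_le_trans; [apply Hw|apply Rmin_r].
    - apply disk_nbhd with (f z). apply Hcd. eapply Rlt_le_trans; [apply Hw|apply Rmin_l]. }
  exists Om. repeat split.
  - auto.
  (* A cover of [Om] is pushed forward to open sets covering the target disk. A common image point
     comes from a single point of [Om] by injectivity. *)
  - intros U V HU HV Hcov (p & Op & Up) (q & Oq & Vq).
    assert (HOW : forall W : C -> Prop, open W ->
       open (fun w => exists z, (Om z /\ W z) /\ f z = w)).
    { intros W HW. apply HUopen. now apply open_and. intros z [[Hz _] _]; auto. }
    destruct (disk_connected rho (fun w => exists z, (Om z /\ U z) /\ f z = w)
      (fun w => exists z, (Om z /\ V z) /\ f z = w)) as (x & _ & (z1 & [O1 U1] & E1) & (z2 & [O2 V2] & E2)); auto.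
    + intros w Hw. rewrite disk_0 in Hw. destruct (Hsurj w Hw) as (z & Hz & E).
      assert (Oz : Om z) by (split; auto; now rewrite E).
      destruct (Hcov z Oz); [left|right]; exists z; auto.
    + exists (f p). split. apply disk_0, Op. exists p; auto.
    + exists (f q). split. apply disk_0, Oq. exists q; auto.
    + exists z1. repeat split; try apply O1; auto.
      replace z1 with z2; auto. apply Hinj; try apply disk_0; try apply O1; try apply O2. congruence.
  - exists (RtoC 0). split. rewrite Cmod_0; lra. rewrite H0, Cmod_0; auto.
  - intros z [Hz _]. apply unit_disk_Cmod. lra.
  - intros z [Hz _]. now apply disk_0.
  - intros z w [Hz _] [Hw _]. apply Hinj; now apply disk_0.
  - intros Hw. rewrite disk_0 in Hw. destruct (Hsurj w Hw) as (z & Hz & E).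
    exists z. split; auto. split; auto. now rewrite E.
  - intros (z & [Hz Hfz] & <-). now apply disk_0.
Qed.

(** * The Landau estimate for harmonic mappings *)

Lemma growth_pos (N rho a : R) : 0 < N -> 0 < rho -> 0 < a < 1 -> 0 < growth N rho a a.
Proof.
  intros HN Hrho Ha. unfold growth. apply Rmult_lt_0_compat. now apply Rmult_lt_0_compat.
  (* With [x = 1 - a^2] the bracket is [1 + x / (1 - x) * ln x]; its positivity is the strict
     inequality [ln (1 / x) < 1 / x - 1]. *)
  assert (Hx : 0 < 1 - a * a < 1) by nra. set (x := 1 - a * a) in *.
  assert (Hl : ln (/ x) < / x - 1).
  { assert (Hix : 1 < / x). { rewrite <- Rinv_1. apply Rinv_lt_contravar; lra. }
    assert (Hln : ln (/ x) <> 0).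
    { apply Rgt_not_eq. rewrite <- ln_1. apply ln_increasing; lra. }
    pose proof (exp_ineq1 _ Hln) as He. rewrite exp_ln in He by lra. lra. }
  rewrite ln_Rinv in Hl by lra.
  replace (a / a) with 1 by (field; lra).
  replace ((1 - a ^ 2) / a ^ 2) with (x / (1 - x))
    by (unfold x; field; repeat split; apply Rgt_not_eq; nra).
  apply Rmult_lt_reg_l with (1 - x); [lra|].
  replace ((1 - x) * (1 + x / (1 - x) * ln x)) with (1 - x + x * ln x) by (field; lra).
  apply (Rmult_lt_compat_l x) in Hl; [|lra].
  replace (x * (/ x - 1)) with (1 - x) in Hl by (field; lra). lra.
Qed.

(** Supplies properness: moduli near the boundary radius force values of [f] larger than any
    prescribed [b] below the limiting growth. *)
Lemma growth_continuous (N rho a : R) : 0 < a < 1 ->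
  forall b, b < growth N rho a a -> exists s, 0 < s < a /\ forall t, s <= t <= a -> b < growth N rho a t.
Proof.
  intros Ha b Hb.
  assert (Hc : continuous (growth N rho a) a).
  { apply (ex_derive_continuous (V := R_NormedModule) (growth N rho a) a).
    unfold growth. auto_derive. nra. }
  assert (Hl : locally (growth N rho a a) (fun y => b < y)).
  { assert (Hp : 0 < growth N rho a a - b) by lra. exists (mkposreal _ Hp).
    intros y Hy. change (Rabs (y - growth N rho a a) < growth N rho a a - b) in Hy.
    apply Rabs_def2 in Hy. lra. }
  apply Hc in Hl. destruct Hl as [d Hd].
  pose proof (cond_pos d).
  exists (Rmax (a / 2) (a - d / 2)). split.
  - split. eapply Rlt_le_trans; [|apply Rmax_l]; lra. apply Rmax_lub_lt; lra.
  - intros t Ht. apply (Hd t). change (Rabs (t - a) < d).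
    pose proof (Rmax_r (a / 2) (a - d / 2)). apply Rabs_def1; lra.
Qed.

Lemma Cconj_as_rotation (G : C) : exists eta, Cmod eta = 1 /\ Cconj G = (eta * G)%C.
Proof.
  (* If [u G = |G|] is real, then [conj u * conj G = u G], so the rotation is [u^2]. *)
  destruct (unimodular_rotation G) as (u & Hu & E). exists (u * u)%C. split.
  - rewrite Cmod_mult, Hu. ring.
  - assert (Huu : (Cconj u * u)%C = RtoC 1).
    { rewrite Cmult_comm, <- Cmod2_conj, Hu. f_equal. ring. }
    assert (Ec : (Cconj u * Cconj G)%C = (u * G)%C).
    { rewrite <- Cmult_conj, E. unfold Cconj, RtoC; simpl. f_equal; ring. }
    transitivity ((Cconj u * u) * Cconj G)%C; [rewrite Huu; ring|].
    transitivity (u * (Cconj u * Cconj G))%C; [ring|]. rewrite Ec. ring.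
Qed.

(* [Cconj (g z1 - g z2)] is a unimodular multiple of [g z1 - g z2], so estimates
   for [f] follow from those for [h + eta * g]. *)
Lemma harmonic_landau (f h g dh dg : C -> C) (rho N : R) :
  0 < rho < 1 -> 1 < N ->
  (forall z, Cmod z < 1 -> f z = (h z + Cconj (g z))%C) ->
  (forall z, Cmod z < 1 -> cderiv h z (dh z)) -> (forall z, Cmod z < 1 -> cderiv g z (dg z)) ->
  (exists d, holoC1 1 dh d) -> (exists d, holoC1 1 dg d) ->
  (forall z, Cmod z < 1 -> Cmod (dg z) < Cmod (dh z)) ->
  (forall z, Cmod z < rho -> Cmod (dh z) + Cmod (dg z) < N) ->
  1 <= Cmod (dh (RtoC 0)) - Cmod (dg (RtoC 0)) -> f (RtoC 0) = RtoC 0 ->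
  univalent_in f (disk (RtoC 0) (rho / N)) /\
  contains_schlicht_disk f (disk (RtoC 0) (rho / N)) (RtoC 0) (growth N rho (/ N) (/ N)).
Proof.
  intros Hrho HN Hf Hh Hg [ddh Hdh] [ddg Hdg] Hsp HNb H1 H0.
  set (a := / N).
  assert (Ha : 0 < a < 1).
  { unfold a. split. apply Rinv_0_lt_compat; lra. rewrite <- Rinv_1. apply Rinv_lt_contravar; lra. }
  assert (HaN : a * N = 1) by (unfold a; field; lra).
  replace (rho / N) with (rho * a) by (unfold a; field; lra).
  set (r := rho * a). assert (Hr : 0 < r < rho) by (unfold r; split; nra).
  (* The rotation [u] may depend on [eta], but the lower bound does not; this permits [eta] to vary
     with the points later. *)
  assert (Hpick : forall eta, Cmod eta = 1 -> exists u, Cmod u = 1 /\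
    (forall z, Cmod z < rho -> cderiv (fun z => h z + eta * g z)%C z (dh z + eta * dg z)%C) /\
    (forall z, Cmod z < rho ->
      N * ((a - Cmod z / rho) / (1 - a * (Cmod z / rho))) <= Re (u * (dh z + eta * dg z))%C)).
  { intros eta Heta.
    set (phi := fun z => (dh z + eta * dg z)%C).
    assert (Hphi : holoC1 rho phi (fun z => ddh z + eta * ddg z)%C).
    { intros z Hz. destruct (Hdh z) as [A1 A2]; [lra|]. destruct (Hdg z) as [B1 B2]; [lra|]. split.
      - apply deriv_along_plus; auto. now apply deriv_along_scal.
      - apply continuous_Cplus; auto. apply continuous_Cmult; auto. apply continuous_Cconst. }
    assert (Hphi0 : 1 <= Cmod (phi (RtoC 0))).
    { assert (Cmod (dh (RtoC 0)) <= Cmod (phi (RtoC 0)) + Cmod (dg (RtoC 0))); [|lra].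
      replace (dh (RtoC 0)) with (phi (RtoC 0) + - (eta * dg (RtoC 0)))%C by (unfold phi; ring).
      eapply Rle_trans; [apply Cmod_triangle|]. rewrite Cmod_opp, Cmod_mult, Heta. lra. }
    exists (Cconj (phi (RtoC 0)) / RtoC (Cmod (phi (RtoC 0))))%C. split; [|split].
    - rewrite Cmod_div, Cmod_conj, Cmod_R, Rabs_pos_eq; try lra. field; lra.
      intros E; injection E; lra.
    - intros z Hz. apply deriv_along_plus. apply Hh; lra. apply deriv_along_scal. apply Hg; lra.
    - intros z Hz. apply (schwarz_pick_re rho N a phi (fun z => ddh z + eta * ddg z)%C); auto; try lra.
      intros w Hw. unfold phi. eapply Rle_lt_trans; [apply Cmod_triangle|].
      rewrite Cmod_mult, Heta, Rmult_1_l. auto. }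
  assert (Hrot : forall z1 z2, Cmod z1 < 1 -> Cmod z2 < 1 -> exists eta, Cmod eta = 1 /\
     (f z1 - f z2)%C = ((h z1 + eta * g z1) - (h z2 + eta * g z2))%C).
  { intros z1 z2 Hz1 Hz2. destruct (Cconj_as_rotation (g z1 - g z2)%C) as (eta & Heta & E).
    exists eta. split; auto. rewrite !Hf by auto. rewrite Cminus_conj in E.
    transitivity ((h z1 - h z2) + (Cconj (g z1) - Cconj (g z2)))%C; [ring|]. rewrite E. ring. }
  (* The Pick bound decreases in the modulus, so its value at [s] serves on the whole smaller disk;
     it is positive since [s / rho < a]. *)
  assert (Hexp : forall s, s < r -> exists c, 0 < c /\ forall z1 z2, Cmod z1 < s -> Cmod z2 < s ->
     c * Cmod (z1 - z2) <= Cmod (f z1 - f z2)).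
  { intros s Hs. destruct (Rle_dec s 0) as [Hs0|Hs0].
    { exists 1. split; [lra|]. intros z1 z2 Hz1. pose proof (Cmod_ge_0 z1). lra. }
    assert (Hsa : 0 < s / rho < a).
    { split. apply Rdiv_lt_0_compat; lra. apply Rmult_lt_reg_r with rho; [lra|].
      unfold Rdiv. rewrite Rmult_assoc, Rinv_l by lra. unfold r in Hs. lra. }
    exists (N * ((a - s / rho) / (1 - a * (s / rho)))). split.
    { apply Rmult_lt_0_compat; [lra|]. apply Rdiv_lt_0_compat; nra. }
    intros z1 z2 Hz1 Hz2. destruct (Hrot z1 z2) as (eta & Heta & E); [lra..|]. rewrite E.
    destruct (Hpick eta Heta) as (u & Hu & HD & HP).
    apply (segment_lower_bound (fun z => h z + eta * g z)%C (fun z => dh z + eta * dg z)%C s _ u); auto.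
    - intros z Hz. apply HD. lra.
    - intros z Hz. eapply Rle_trans; [|apply HP; lra]. apply Rmult_le_compat_l; [lra|].
      apply pick_bound_monotone; try lra. split.
      + apply Rmult_le_pos. apply Cmod_ge_0. apply Rlt_le, Rinv_0_lt_compat; lra.
      + apply Rmult_le_compat_r; [|lra]. apply Rlt_le, Rinv_0_lt_compat; lra. }
  assert (Hinj : univalent_in f (disk (RtoC 0) r)).
  { intros z w Hz Hw E. rewrite disk_0 in Hz, Hw.
    pose proof (Rmax_l (Cmod z) (Cmod w)). pose proof (Rmax_r (Cmod z) (Cmod w)).
    assert (Rmax (Cmod z) (Cmod w) < r) by now apply Rmax_lub_lt.
    (* The expansion constants exist only for radii below [r], so one is chosen between the two
       moduli and [r]. *)
    destruct (Hexp ((Rmax (Cmod z) (Cmod w) + r) / 2)) as (c & Hc & Hce); [lra|].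
    specialize (Hce z w ltac:(lra) ltac:(lra)).
    apply Ceq_minus in E. rewrite E, Cmod_0 in Hce.
    apply Ceq_minus, Cmod_eq_0. pose proof (Cmod_ge_0 (z - w)%C). nra. }
  split; auto.
  apply schlicht_disk_of_proper; auto.
  - lra.
  - apply growth_pos; lra.
  - intros z Hz. apply continuous_C_Cmod. intros eps He.
    assert (Hz1 : Cmod z < 1) by lra.
    assert (Hc : continuous (fun z => h z + Cconj (g z))%C z).
    { apply continuous_Cplus. eapply cderiv_continuous; eauto.
      apply continuous_Cconj. eapply cderiv_continuous; eauto. }
    destruct (proj1 (continuous_C_Cmod _ _) Hc eps He) as (d & Hd & H).
    exists (Rmin d (1 - Cmod z)). split. apply Rmin_glb_lt; lra.
    intros w Hw. rewrite !Hf; auto.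
    + apply H. eapply Rlt_le_trans; [apply Hw|apply Rmin_l].
    + apply disk_nbhd with z. eapply Rlt_le_trans; [apply Hw|apply Rmin_r].
  - intros z Hz e He. assert (Hz1 : Cmod z < 1) by lra.
    destruct (harmonic_open_at h g dh dg 1 z Hh Hg Hz1) with (e := Rmin e (1 - Cmod z))
      as (d & Hd & H); auto.
    + destruct (Hdh z Hz1). eapply cderiv_continuous; eauto.
    + destruct (Hdg z Hz1). eapply cderiv_continuous; eauto.
    + apply Rmin_glb_lt; lra.
    + exists d; split; auto. intros w Hw. rewrite Hf in Hw by auto.
      destruct (H w Hw) as (z' & Hz' & E). exists z'. split.
      * eapply Rlt_le_trans; [apply Hz'|apply Rmin_l].
      * rewrite Hf; auto. apply disk_nbhd with z. eapply Rlt_le_trans; [apply Hz'|apply Rmin_r].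
  - intros b Hb. destruct (growth_continuous N rho a Ha b Hb) as (s & Hs & H).
    exists (rho * s). split. unfold r. apply Rmult_lt_compat_l; lra.
    intros z Hz Hfz. apply Rnot_le_lt. intros Hle.
    assert (Hzr : s <= Cmod z / rho <= a).
    { unfold r in Hz. split; apply Rmult_le_reg_r with rho; try lra; unfold Rdiv;
        rewrite Rmult_assoc, Rinv_l; lra. }
    specialize (H _ Hzr).
    destruct (Hrot z (RtoC 0)) as (eta & Heta & E); [lra|rewrite Cmod_0; lra|].
    destruct (Hpick eta Heta) as (u & Hu & HD & HP).
    assert (HG : growth N rho a (Cmod z / rho) <= Cmod (f z - f (RtoC 0))%C).
    { rewrite E. apply (radial_lower_bound (fun z => h z + eta * g z)%C (fun z => dh z + eta * dg z)%C N rho a u); auto; lra. }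
    rewrite H0 in HG. replace (f z - 0)%C with (f z) in HG by ring. lra.
Qed.

(** * From the Bloch condition to the Landau estimate *)

Theorem theorem3p6 (K B : R) (f h g : C -> C)
  (hK : 1 <= K)
  (hf : quasiregular_harmonic K f)
  (hh : analytic h)
  (hg : analytic g)
  (hfhg : forall z : C, unit_disk z -> f z = (h z + Cconj (g z))%C)
  (hf0 : f (RtoC 0) = RtoC 0)
  (hlambda : lambda f (RtoC 0) = 1)
  (hB : 0 < B)
  (hBloch : Rbar_le (bloch_seminorm h) (Finite B)) :
  1 <= B /\
  univalent_in f (disk (RtoC 0) (r12 K B)) /\
  contains_schlicht_disk f (disk (RtoC 0) (r12 K B)) (RtoC 0) (r13 K B).
Proof.
  destruct hf as (Hharm & Hsense & Hqr).
  assert (HW := fun z => wirtinger_decomposition f h g z hh hg hfhg).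
  assert (Hsp : forall z, Cmod z < 1 -> Cmod (C_derive g z) < Cmod (C_derive h z)).
  { intros z Hz. destruct (HW z Hz) as [E1 E2].
    assert (HJ := Hsense z (proj2 (unit_disk_Cmod z) Hz)).
    unfold Jacobian in HJ. rewrite E1, E2, Cmod_conj in HJ.
    pose proof (Cmod_ge_0 (C_derive g z)). pose proof (Cmod_ge_0 (C_derive h z)). nra. }
  (* Sense preservation removes the absolute value in [lambda]; quasiregularity then reads
     [(K + 1) |g'| <= (K - 1) |h'|], and adding [(K + 1) |h'|] gives the claim. *)
  assert (HQ : forall z, Cmod z < 1 ->
     (K + 1) * (Cmod (C_derive h z) + Cmod (C_derive g z)) <= 2 * K * Cmod (C_derive h z)).
  { intros z Hz. destruct (HW z Hz) as [E1 E2].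
    assert (Hl := Hqr z (proj2 (unit_disk_Cmod z) Hz)). specialize (Hsp z Hz).
    unfold Lambda, lambda in Hl. rewrite E1, E2, Cmod_conj in Hl.
    rewrite Rabs_pos_eq in Hl by lra. lra. }
  assert (HBl : forall z, Cmod z < 1 -> (1 - Cmod z ^ 2) * Cmod (C_derive h z) <= B).
  { intros z Hz. unfold bloch_seminorm in hBloch.
    destruct (Lub_Rbar_correct (fun x : R =>
      exists z : C, unit_disk z /\ x = (1 - Cmod z ^ 2) * Cmod (C_derive h z))) as [Hub _].
    refine (Rbar_le_trans (Finite _) _ (Finite B) (Hub _ _) hBloch).
    exists z. split; auto. now apply unit_disk_Cmod. }
  assert (H00 : Cmod (RtoC 0) < 1) by (rewrite Cmod_0; lra).
  assert (H1 : Cmod (C_derive h (RtoC 0)) - Cmod (C_derive g (RtoC 0)) = 1).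
  { destruct (HW _ H00) as [E1 E2]. specialize (Hsp _ H00).
    unfold lambda in hlambda. rewrite E1, E2, Cmod_conj, Rabs_pos_eq in hlambda by lra. auto. }
  (* At the origin the Bloch bound is [|h'(0)| <= B], while [|h'(0)| = 1 + |g'(0)|]. *)
  assert (HB1 : 1 <= B).
  { specialize (HBl _ H00). rewrite Cmod_0 in HBl.
    pose proof (Cmod_ge_0 (C_derive g (RtoC 0))). lra. }
  split; auto.
  set (N := 3 * K * B / (K + 1)). set (rho := / sqrt 3).
  assert (H3 : 0 < sqrt 3) by (apply sqrt_lt_R0; lra).
  assert (H33 : sqrt 3 * sqrt 3 = 3) by (apply sqrt_sqrt; lra).
  assert (Hrho : 0 < rho < 1).
  { unfold rho. split. now apply Rinv_0_lt_compat. rewrite <- Rinv_1. apply Rinv_lt_contravar; nra. }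
  assert (Hrho2 : rho * rho = / 3).
  { unfold rho. rewrite <- Rinv_mult, H33. auto. }
  assert (HN : 1 < N).
  { unfold N. apply Rmult_lt_reg_r with (K + 1); [lra|].
    unfold Rdiv. rewrite Rmult_assoc, Rinv_l by lra. nra. }
  destruct (harmonic_landau f h g (C_derive h) (C_derive g) rho N) as [HU HS]; auto.
  - intros z Hz. apply hfhg. now apply unit_disk_Cmod.
  - intros z Hz. now apply analytic_cderiv.
  - intros z Hz. now apply analytic_cderiv.
  - destruct (harmonic_dz_holoC1 f Hharm) as [d Hd]. exists d.
    eapply holoC1_ext; [|apply Hd]. intros z Hz. apply (HW z Hz).
  - destruct (harmonic_conj_dzbar_holoC1 f Hharm) as [d Hd]. exists d.
    eapply holoC1_ext; [|apply Hd]. intros z Hz. simpl. destruct (HW z Hz) as [_ E].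
    rewrite E. apply Cconj_conj.
  - intros z Hz. assert (Hz1 : Cmod z < 1) by lra.
    specialize (HBl z Hz1). specialize (HQ z Hz1). pose proof (Cmod_ge_0 z).
    pose proof (Cmod_ge_0 (C_derive h z)) as Hp.
    assert (Hz2 : Cmod z ^ 2 < / 3) by nra.
    assert (HP : Cmod (C_derive h z) < 3 / 2 * B).
    (* Multiplying the strict [1 - |z|^2 > 2/3] by [|h'|] keeps it strict only for [h' <> 0];
       otherwise the claim follows from [0 < B]. *)
    { destruct (Req_dec (Cmod (C_derive h z)) 0) as [->|Hne]; nra. }
    apply Rmult_lt_reg_l with (K + 1); [lra|].
    replace ((K + 1) * N) with (3 * K * B) by (unfold N; field; lra). nra.
  - lra.
  - replace (r12 K B) with (rho / N) by (unfold r12, rho, N; field; lra).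
    replace (r13 K B) with (growth N rho (/ N) (/ N)); auto.
    unfold r13, growth.
    replace (1 - / N * / N) with (1 - (K + 1) ^ 2 / (9 * K ^ 2 * B ^ 2))
      by (unfold N; field; lra).
    replace (N * rho) with (sqrt 3 * K * B / (K + 1)).
    + replace ((1 - (/ N) ^ 2) / (/ N) ^ 2) with (9 * K ^ 2 * B ^ 2 / (K + 1) ^ 2 - 1)
        by (unfold N; field; lra).
      replace (/ N / / N) with 1 by (field; lra). auto.
    + unfold N, rho. replace (3 * K * B) with (sqrt 3 * sqrt 3 * K * B) by (rewrite H33; auto).
      field. lra.
Qed.
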